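(* Let $n\ge0$, $k\ge0$. The map $F:\mathcal{C}_n^k\to\mathcal{T}_n^k$ described in the context is a bijection, and $w_{\mathcal{T}}^{\mathrm{st}}(F(\lambda))=w_{\mathcal{C}}^{\mathrm{lr}}(\lambda)$ for every $\lambda\in\mathcal{C}_n^k$.
   Context: Colored symbols: $i^r$ (red $i$), $j^b$ (blue $j$), compared within a color by value. $\mathcal{C}_n^k$ is the set of double Callan permutations: pairs of possibly empty strings $(S_1,S_2)$ using each of $1^r,\dots,n^r,1^b,\dots,k^b$ exactly once in total, with $S_1$ (if nonempty) starting blue, $S_2$ (if nonempty) starting red, and every maximal one-colored run decreasing. Write $S_1=B_1R_1\cdots B_\ell R_\ell B_{\ell+1}$, $S_2=R'_1B'_1\cdots R'_mB'_mR'_{m+1}$ ($B$ blue runs, $R$ red runs, $\ell,m\ge0$, $B_{\ell+1},R'_{m+1}$ possibly empty). $B_{\ell+1},R'_{m+1}$ are the extra blocks; the other runs are ordinary blocks, and $(B_i,R_i)$, $(R'_j,B'_j)$ are Callan pairs. $w_{\mathcal{C}}^{\mathrm{lr}}(\lambda)$ = number of $i\in\{1,\dots,\ell\}$ with $\min B_i<\min B_j$ for all $j<i$. $\mathcal{T}_n^k$ ($n,k\ge1$): partial fillings of an $n\times k$ rectangle (rows $1..n$ from top, columns $1..k$ from left) with $\leftarrow$ and $\downarrow$ such that every cell strictly left of a $\leftarrow$ in its row and strictly below a $\downarrow$ in its column is empty; if $n=0$ or $k=0$ it consists of one empty tableau. $w_{\mathcal{T}}^{\mathrm{st}}$: take the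 maximal initial run of rows $1,\dots,r$ each containing a $\leftarrow$, and count rows $i\le r$ whose $\leftarrow$ is strictly left of the $\leftarrow$'s of all rows above $i$ (weight $0$ for the empty tableau). The map $\varphi:\mathcal{C}_n^k\to\bigcup_{i\le n}\mathcal{C}_i^{k-1}$ ($k\ge1$): (1) if $k^b\in B_{\ell+1}$, delete $k^b$; (2) if $\ell\ge1$ and $B_1$ consists of $k^b$ alone, delete $B_1R_1$; (3) otherwise $k^b$ lies in an ordinary blue block; let $R$ be the red block of its Callan pair; delete $k^b$, replace $R$ by the single red element $0^r$, and if this makes $0^r$ adjacent to another red run, merge them in decreasing order. Finally relabel the red elements order-preservingly as $1^r,2^r,\dots$. The column $\lambda_k$ (an $n\times1$ filling, row $r$ associated with $r^r$; $R$ as in (3)): (1) if $k^b\in B_{\ell+1}$, $\lambda_k$ is empty; (2) if $\ell\ge1$ and $B_1=(k^b)$ (so $R=R_1$): the cell in row $1$ is $\leftarrow$; moreover (a) if $1^r\in R$, put $\leftarrow$ in rows $r\in R$; (b) if $1^r\notin R$, put $\downarrow$ in row $\max R$ and $\leftarrow$ in rows $r\in R\setminus\{\max R\}$; (3) otherwise: (a) if $|R|=1$, put $\downarrow$ in row $r\in R$; (b) if $|R|>1$ and $1^r\in R$, put $\leftarrow$ in rows $r\in R\setminus\{1\}$; (c) if $|R|>1$ and $1^r\notin R$, put $\downarrow$ in row $\max R$ and $\leftarrow$ in rows $r\in R\setminus\{\max R\}$. The map $F$ is defined recursively: if $k=0$ or $n=0$, $F(\lambda)$ is the empty tableau. Otherwise,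 column $k$ of $F(\lambda)$ is $\lambda_k$; if $\lambda_k$ has $p$ left arrows then $\varphi(\lambda)\in\mathcal{C}_{n-p}^{k-1}$, the rows of $F(\lambda)$ containing a $\leftarrow$ in column $k$ are empty in columns $1,\dots,k-1$, and the remaining $n-p$ rows, identified in top-to-bottom order with rows $1,\dots,n-p$, carry in columns $1,\dots,k-1$ the tableau $F(\varphi(\lambda))$. *)

(* Defs.v *)
From HB Require Import structures.
From mathcomp Require Import all_boot matrix.

Set Implicit Arguments.
Unset Strict Implicit.
Unset Printing Implicit Defensive.

(* A colored symbol is a pair (is it red?, value).  Values are 1-based, as is
   the numbering of rows and columns by naturals; 0^r only appears in phi. *)
Definition symbol : Type := (bool * nat)%type.
Definition red (i : nat) : symbol := (true, i).
Definition blue (j : nat) : symbol := (false, j).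
Definition is_red (x : symbol) : bool := x.1.
Definition value (x : symbol) : nat := x.2.

(* The maximal one-colored runs of a string, from left to right. *)
Fixpoint runs (s : seq symbol) : seq (seq symbol) :=
  if s is x :: s' then
    match runs s' with
    | (y :: r) :: rs =>
        if is_red x == is_red y then (x :: y :: r) :: rs
        else [:: x] :: (y :: r) :: rs
    | _ => [:: [:: x]]
    end
  else [::].

Definition decreasing (r : seq symbol) : bool :=
  sorted (fun x y => value y < value x) r.

Definition is_double_callan (n k : nat) (l : seq symbol * seq symbol) : bool :=
  [&& perm_eq (l.1 ++ l.2) (map red (iota 1 n) ++ map blue (iota 1 k)),
      if l.1 is x :: _ then ~~ is_red x else true,
      if l.2 is x :: _ then is_red x else true,
      all decreasing (runs l.1)
    & all decreasing (runs l.2)].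

(* Runs alternate in color, so grouping them two by two yields the pairs
   (B_i, R_i) of S_1, resp. (R'_j, B'_j) of S_2; a last unpaired run is the
   extra block, which is empty when the number of runs is even. *)
Fixpoint pair_up (rs : seq (seq symbol)) : seq (seq symbol * seq symbol) :=
  if rs is X :: Y :: rs' then (X, Y) :: pair_up rs' else [::].

Fixpoint unpaired (rs : seq (seq symbol)) : seq symbol :=
  match rs with
  | [::] => [::]
  | [:: X] => X
  | _ :: _ :: rs' => unpaired rs'
  end.

Definition callan_pairs (s : seq symbol) := pair_up (runs s).
Definition extra_block (s : seq symbol) := unpaired (runs s).

Definition assemble (ps : seq (seq symbol * seq symbol)) (e : seq symbol) :
    seq symbol :=
  flatten [seq p.1 ++ p.2 | p <- ps] ++ e.

Definition block_min (B : seq symbol) : nat :=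
  \big[minn/value (head (blue 0) B)]_(x <- B) value x.

Definition block_max (R : seq symbol) : nat := \max_(x <- R) value x.

Definition w_lr (l : seq symbol * seq symbol) : nat :=
  let ps := callan_pairs l.1 in
  let minB i := block_min (nth ([::], [::]) ps i).1 in
  #|[set i : 'I_(size ps) |
       [forall j : 'I_(size ps), (j < i) ==> (minB i < minB j)]]|.

Inductive cell : Type := Empty | LeftArrow | DownArrow.

Definition cell_code (c : cell) : option bool :=
  match c with Empty => None | LeftArrow => Some true | DownArrow => Some false end.
Definition cell_decode (o : option bool) : cell :=
  match o with None => Empty | Some b => if b then LeftArrow else DownArrow end.
Lemma cell_codeK : cancel cell_code cell_decode.
Proof. by case. Qed.
HB.instance Definition _ := Finite.copy cell (can_type cell_codeK).

(* Entry (i, j), with 0-based ordinals, is the cell in row i+1 and column j+1;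
   row indices increase downwards. *)
Definition is_tableau (n k : nat) (t : 'M[cell]_(n, k)) : bool :=
  [forall i, forall j, (t i j == LeftArrow) ==>
     [forall j' : 'I_k, (j' < j) ==> (t i j' == Empty)]] &&
  [forall i, forall j, (t i j == DownArrow) ==>
     [forall i' : 'I_n, (i < i') ==> (t i' j == Empty)]].

Definition row_has_left (n k : nat) (t : 'M[cell]_(n, k)) (i : 'I_n) : bool :=
  [exists j, t i j == LeftArrow].

Definition in_initial_run (n k : nat) (t : 'M[cell]_(n, k)) (i : 'I_n) : bool :=
  [forall i' : 'I_n, (i' <= i) ==> row_has_left t i'].

Definition leftmost_so_far (n k : nat) (t : 'M[cell]_(n, k)) (i : 'I_n) : bool :=
  [exists j : 'I_k, (t i j == LeftArrow) &&
     [forall i' : 'I_n, (i' < i) ==>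
        [forall j' : 'I_k, (t i' j' == LeftArrow) ==> (j < j')]]].

Definition w_st (n k : nat) (t : 'M[cell]_(n, k)) : nat :=
  #|[set i : 'I_n | in_initial_run t i && leftmost_so_far t i]|.

Definition in_case1 (k : nat) (l : seq symbol * seq symbol) : bool :=
  blue k \in extra_block l.1.

Definition in_case2 (k : nat) (l : seq symbol * seq symbol) : bool :=
  if callan_pairs l.1 is (B, _) :: _ then B == [:: blue k] else false.

(* The red block of the Callan pair whose blue block contains k^b. *)
Definition red_partner (k : nat) (l : seq symbol * seq symbol) : seq symbol :=
  head [::] ([seq p.2 | p <- callan_pairs l.1 & blue k \in p.1] ++
             [seq p.1 | p <- callan_pairs l.2 & blue k \in p.2]).

(* Sorting every run decreasingly: blocks that are already decreasing are
   unchanged, and red runs that have become adjacent are merged. *)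
Definition merge_runs (s : seq symbol) : seq symbol :=
  flatten [seq sort (fun x y => value y <= value x) r | r <- runs s].

Definition relabel_reds (l : seq symbol * seq symbol) :
    seq symbol * seq symbol :=
  let reds := [seq x <- l.1 ++ l.2 | is_red x] in
  let f x := if is_red x then red (count (fun y => value y <= value x) reds)
             else x in
  (map f l.1, map f l.2).

Definition phi (k : nat) (l : seq symbol * seq symbol) :
    seq symbol * seq symbol :=
  relabel_reds
    (if in_case1 k l then
       (rem (blue k) l.1, l.2)
     else if in_case2 k l then
       (assemble (behead (callan_pairs l.1)) (extra_block l.1), l.2)
     else
       (merge_runs (assemble
          [seq if blue k \in p.1 then (rem (blue k) p.1, [:: red 0]) else p
             | p <- callan_pairs l.1] (extra_block l.1)),
        merge_runs (assemble
          [seq if blue k \in p.2 then ([:: red 0], rem (blue k) p.2) else p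
             | p <- callan_pairs l.2] (extra_block l.2)))).

(* The cell in row r of the column lambda_k. *)
Definition last_column (k : nat) (l : seq symbol * seq symbol) (r : nat) : cell :=
  let R := red_partner k l in
  if in_case1 k l then Empty
  else if in_case2 k l then
    if red 1 \in R then
      if red r \in R then LeftArrow else Empty
    else
      if r == 1 then LeftArrow
      else if r == block_max R then DownArrow
      else if red r \in R then LeftArrow else Empty
  else if size R == 1 then
    if red r \in R then DownArrow else Empty
  else if red 1 \in R then
    if (red r \in R) && (r != 1) then LeftArrow else Empty
  else
    if r == block_max R then DownArrow
    else if red r \in R then LeftArrow else Empty.

(* The cell in row r and column c of F(lambda).  A row r with no left arrow in
   column k is identified with the row of F(phi(lambda)) whose number is its
   rank among the rows with no left arrow in column k. *)
Fixpoint F_cell (k : nat) (l : seq symbol * seq symbol) (r c : nat) : cell :=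
  if k is k'.+1 then
    if c == k then last_column k l r
    else if last_column k l r == LeftArrow then Empty
    else F_cell k' (phi k l)
           (count (fun i => last_column k l i != LeftArrow) (iota 1 r)) c
  else Empty.

Definition F (n k : nat) (l : seq symbol * seq symbol) : 'M[cell]_(n, k) :=
  \matrix_(i < n, j < k) F_cell k l i.+1 j.+1.

(* Main.v *)
Require Import Defs.
From mathcomp Require Import all_boot matrix.
From mathcomp Require Import zify.

(** Both F and its inverse peel off the last column.  Listing the blocks of
    [S_2] after those of [S_1] but in reverse order, the map phi removes k^b and
    its red partner block [R]; whenever this would destroy an ordinary blue
    block other than the very first one, the marker 0^r that replaces [R] joins
    the red block before it.  Hence, before relabelling, phi is undone by one
    rule: a marker alone in its ordinary block means that k^b belonged to the
    blue block of the same pair, any other marker means that a pair ({k^b}, R)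
    has to be inserted there.  So a double Callan permutation is the same thing
    as a case number, a set [R] (empty in case 1) and a smaller double Callan
    permutation, while (case, [R]) is exactly the information carried by the
    last column; induction on k gives the bijection.

    For the weights, a record among the left arrows that lies in column k can
    only occur in row 1, and row 1 has its left arrow in column k precisely in
    case 2, where the deleted first pair is a record that phi does not change
    for the other pairs.  All other records are preserved by phi. *)

Set Implicit Arguments.
Unset Strict Implicit.
Unset Printing Implicit Defensive.

(** * Strings and their blocks *)

(** The obstacle is that [phi] is a computation on strings: it searches for k^b, edits a block,
    sorts runs and relabels. The relation [step] therefore tabulates the seven local shapes that a
    permutation can have around its largest blue symbol, each next to the shape left behind. Four
    facts about this table carry the argument: [l] determines what [phi] and the column see
    ([step_viewP]), the case, [R] and [l0] determine [l] ([step_undo]), every [l] occurs on the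
    right ([step_onto]), and every admissible [l0] occurs on the left ([step_from]). The sizes fit
    for the following reason. A column has |R| left arrows in case (2) and |R| - 1 in case (3); in
    the latter the marker survives as one extra red symbol. So the rows without left arrow are
    always as many as the red symbols of the image. *)

Notation block := (seq symbol).
Notation block_pair := (block * block)%type.

Arguments decreasing : simpl never.

Definition colored (c : bool) : pred symbol := fun x => is_red x == c.

(** May be empty: this is the condition on an extra block, whereas [proper_block] is the one on
    ordinary blocks. *)
Definition colored_block (c : bool) (X : block) : bool :=
  all (colored c) X && decreasing X.

Definition proper_block (c : bool) (X : block) : bool :=
  (X != [::]) && colored_block c X.

Definition proper_pair (c : bool) (p : block_pair) : bool :=
  proper_block c p.1 && proper_block (~~ c) p.2.

(** True on the empty string, so that empty words and missing extra blocks need no separate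
    treatment. *)
Definition starts (c : bool) (s : seq symbol) : bool :=
  if s is x :: _ then is_red x == c else true.

Definition callan_word (c : bool) (s : seq symbol) : bool :=
  starts c s && all decreasing (runs s).

Lemma decreasing_map (f : symbol -> symbol) (X : block) :
  {in X &, forall x y, value x < value y -> value (f x) < value (f y)} ->
  decreasing X -> decreasing (map f X).
Proof.
rewrite /decreasing; elim: X => //= x [|y X] IH //= H /andP[xy dX].
rewrite H ?inE ?eqxx ?orbT //=; apply: IH dX => u v uX vX.
by apply: H; rewrite inE ?uX ?vX orbT.
Qed.

Lemma runs_cat c X s :
  X != [::] -> all (colored c) X -> starts (~~ c) s ->
  runs (X ++ s) = X :: runs s.
Proof.
move=> X0 cX ss; elim: X X0 cX => //= x [|y X] IH _ /=.
  rewrite andbT => /eqP xc; case: s ss {IH} => //= y s /eqP yc.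
  by case: (runs s) => [|[|z r] rs] /=; last case: ifP => _ /=; rewrite xc yc;
    case: (c).
case/andP=> xc cX; have /= -> := IH isT cX.
by case/andP: cX => yc _; rewrite (eqP xc) (eqP yc) eqxx.
Qed.

Lemma runs1 c X : X != [::] -> all (colored c) X -> runs X = [:: X].
Proof. by move=> X0 cX; rewrite -[X in runs X]cats0 (runs_cat X0 cX). Qed.

Lemma starts_proper_block c X s : proper_block c X -> starts c (X ++ s).
Proof. by case: X => [|x X] //= /andP[_ /andP[/andP[]]]. Qed.

Lemma starts_assemble c ps e :
  all (proper_pair c) ps -> colored_block c e -> starts c (assemble ps e).
Proof.
case: ps => [|p ps] /=; first by case: e => //= x e _ /andP[/andP[]].
case/andP=> /andP[H _] _ _; rewrite /assemble /= -!catA; exact: starts_proper_block.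
Qed.

Lemma assemble_cons p ps e : assemble (p :: ps) e = p.1 ++ p.2 ++ assemble ps e.
Proof. by rewrite /assemble /= !catA. Qed.

Lemma assemble_cat ps qs e : assemble (ps ++ qs) e = assemble ps (assemble qs e).
Proof. by rewrite /assemble map_cat flatten_cat catA. Qed.

Lemma runs_assemble c ps e :
  all (proper_pair c) ps -> colored_block c e ->
  runs (assemble ps e)
    = flatten [seq [:: p.1; p.2] | p <- ps] ++ (if e is [::] then [::] else [:: e]).
Proof.
elim: ps => [_|p ps IH /= /andP[/andP[H1 H2] Hps] He].
  by rewrite /assemble /=; case: e => // x e /andP[H _]; rewrite (runs1 _ H).
have [n1 /andP[c1 _]] := andP H1; have [n2 /andP[c2 _]] := andP H2.
rewrite assemble_cons (runs_cat n1 c1) ?(runs_cat n2 c2) ?IH //.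
  by rewrite negbK starts_assemble.
exact: starts_proper_block.
Qed.

(** Together with [extra_block_assemble] and [callan_word_blocks], this makes the block
    decomposition unique, so that words can be edited as lists of pairs. *)
Lemma callan_pairs_assemble c ps e :
  all (proper_pair c) ps -> colored_block c e -> callan_pairs (assemble ps e) = ps.
Proof.
move=> Hps He; rewrite /callan_pairs (runs_assemble Hps He).
elim: ps {Hps} => [|[X Y] ps /= ->] //; by case: e {He}.
Qed.

Lemma extra_block_assemble c ps e :
  all (proper_pair c) ps -> colored_block c e -> extra_block (assemble ps e) = e.
Proof.
move=> Hps He; rewrite /extra_block (runs_assemble Hps He).
elim: ps {Hps} => [|[X Y] ps /= ->] //; by case: e {He}.
Qed.

Lemma callan_word_assemble c ps e :
  all (proper_pair c) ps -> colored_block c e -> callan_word c (assemble ps e).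
Proof.
move=> Hps He; rewrite /callan_word starts_assemble //= (runs_assemble Hps He) all_cat.
apply/andP; split; last by case: e He => // x e /andP[_ de]; rewrite all_seq1.
elim: ps Hps => //= p ps IH /andP[/andP[/and3P[_ _ d1] /and3P[_ _ d2]] /IH ->].
by rewrite d1 d2.
Qed.

Fixpoint alternating (c : bool) (rs : seq block) : bool :=
  if rs is X :: rs' then [&& X != [::], all (colored c) X & alternating (~~ c) rs']
  else true.

Lemma alternating_runs c s : starts c s -> alternating c (runs s).
Proof.
elim: s c => //= x [|y0 s] IH c /eqP xc; first by rewrite /= /colored xc eqxx.
have := IH (is_red y0) (eqxx _); move: (y0 :: s) (is_red y0) => t d /=.
case: (runs t) => [|[|y r] rs] /=; rewrite /colored ?xc ?eqxx //.
case/andP=> /andP[/eqP yd ar] aa; rewrite yd.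
by case: c d xc yd ar aa => [] [] xc yd ar aa; rewrite /= /colored ?xc ?yd ?ar.
Qed.

Lemma flatten_runs s : flatten (runs s) = s.
Proof.
elim: s => // x [|y0 s] // IH.
have := @alternating_runs (is_red y0) (y0 :: s) (eqxx _); move: IH.
move: (y0 :: s) => t /=; case: (runs t) => [|[|y r] rs] //= => [<-|<- _] //.
by case: ifP.
Qed.

Lemma proper_pair_up c rs :
  alternating c rs -> all decreasing rs ->
  all (proper_pair c) (pair_up rs) && colored_block c (unpaired rs).
Proof.
(* Strong induction on the length, since [pair_up] consumes two runs at a time. *)
have [m] := ubnP (size rs); elim: m rs => // m IH [|X [|Y rs]] //=.
  by rewrite /colored_block !andbT => _ /andP[_ ->].
rewrite /proper_pair /proper_block /colored_block !ltnS =>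
  szr /and3P[-> -> /and3P[-> -> ar]].
case/and3P=> -> -> dr; rewrite negbK in ar.
exact: IH (leq_trans (leqnSn _) szr) ar dr.
Qed.

Lemma assemble_pair_up rs : assemble (pair_up rs) (unpaired rs) = flatten rs.
Proof.
have [m] := ubnP (size rs); elim: m rs => // m IH [|X [|Y rs]] //=.
  by rewrite cats0.
by rewrite !ltnS => szr; rewrite assemble_cons /= IH // (leq_trans (leqnSn _)).
Qed.

Lemma callan_word_blocks c s :
  callan_word c s ->
  [/\ s = assemble (callan_pairs s) (extra_block s),
      all (proper_pair c) (callan_pairs s) & colored_block c (extra_block s)].
Proof.
case/andP=> /alternating_runs alt dec.
rewrite assemble_pair_up flatten_runs.
by have /andP[] := proper_pair_up alt dec.
Qed.

(* Double Callan permutations whose red values range over [U] instead of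
   [1..n]: before relabelling, phi yields the red set [[1..n] \ R], possibly
   with the marker 0 added. *)
Definition callan_over (U : seq nat) (k : nat) (l : seq symbol * seq symbol) : bool :=
  [&& perm_eq (l.1 ++ l.2) (map red U ++ map blue (iota 1 k)),
      callan_word false l.1 & callan_word true l.2].

Lemma is_double_callan_over n k l :
  is_double_callan n k l = callan_over (iota 1 n) k l.
Proof.
rewrite /is_double_callan /callan_over /callan_word; congr (_ && _).
case: l => s1 s2 /=; rewrite -[RHS]andbA andbCA.
case: s1 s2 => [|[[] x] s1] [|[[] y] s2] //=; rewrite ?andbT //.
all: by rewrite ?andbF.
Qed.

Variant blocks_spec (U : seq nat) k : seq symbol * seq symbol -> Prop :=
  BlocksSpec ps1 e1 ps2 e2 of
    all (proper_pair false) ps1 & colored_block false e1 & all (proper_pair true) ps2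
      & colored_block true e2
    & perm_eq (assemble ps1 e1 ++ assemble ps2 e2)
              (map red U ++ map blue (iota 1 k)) :
    blocks_spec U k (assemble ps1 e1, assemble ps2 e2).

Lemma callan_overP U k l : reflect (blocks_spec U k l) (callan_over U k l).
Proof.
apply: (iffP and3P) => [[]|[]].
  case: l => s1 s2 /= pe /callan_word_blocks[E1 p1 q1] /callan_word_blocks[E2 p2 q2].
  by rewrite E1 E2; constructor; rewrite -?E1 -?E2.
by move=> ps1 e1 ps2 e2 p1 q1 p2 q2 pe; split=> //; apply: callan_word_assemble.
Qed.

(** * Relabelling red symbols *)

(** On an increasing [U] this is the 1-based position of [v]. It serves twice: for relabelling red
    symbols and for renumbering the rows without left arrow. *)
Definition rank (U : seq nat) (v : nat) : nat := count (fun y => y <= v) U.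
Definition unrank (U : seq nat) (i : nat) : nat := nth 0 U i.-1.

Lemma rank_nth U i : sorted ltn U -> i < size U -> rank U (nth 0 U i) = i.+1.
Proof.
rewrite /rank; elim: U i => //= x U IH i.
rewrite path_sortedE; last exact: ltn_trans.
case/andP=> xU sU; case: i => [_|i] /=.
  rewrite leqnn; congr _.+1; apply/eqP; rewrite -leqn0 leqNgt -has_count.
  by apply/hasPn => y /(allP xU); rewrite -ltnNge.
rewrite ltnS => iU; rewrite IH // ltnW //.
exact: (allP xU) _ (mem_nth 0 iU).
Qed.

Lemma rankK U v : sorted ltn U -> v \in U -> unrank U (rank U v) = v.
Proof.
move=> sU vU; rewrite -{1}(nth_index 0 vU) rank_nth ?index_mem //.
exact: nth_index.
Qed.

Lemma unrankK U i : sorted ltn U -> i \in iota 1 (size U) ->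
  rank U (unrank U i) = i.
Proof.
by rewrite mem_iota; case: i => // i sU; rewrite add1n ltnS => iU; apply: rank_nth.
Qed.

Lemma map_unrank U : map (unrank U) (iota 1 (size U)) = U.
Proof.
apply: (@eq_from_nth _ 0); rewrite size_map size_iota // => i iU.
by rewrite (nth_map 0) ?size_iota // nth_iota.
Qed.

Lemma map_rank U : sorted ltn U -> map (rank U) U = iota 1 (size U).
Proof.
move=> sU; apply: (@eq_from_nth _ 0); rewrite size_map ?size_iota // => i iU.
by rewrite (nth_map 0) // nth_iota // rank_nth.
Qed.

Definition recolor_red (h : nat -> nat) (x : symbol) : symbol :=
  if is_red x then red (h (value x)) else x.

Lemma is_red_recolor h x : is_red (recolor_red h x) = is_red x.
Proof. by case: x => [[]]. Qed.

Lemma runs_map f s :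
  (forall x, is_red (f x) = is_red x) -> runs (map f s) = map (map f) (runs s).
Proof.
move=> fc; elim: s => //= x s ->; case: (runs s) => [|[|y r] rs] //=.
by rewrite !fc; case: ifP.
Qed.

Lemma callan_pairs_map f s :
  (forall x, is_red (f x) = is_red x) ->
  callan_pairs (map f s) = [seq (map f p.1, map f p.2) | p <- callan_pairs s].
Proof.
move=> fc; rewrite /callan_pairs runs_map //.
have [m] := ubnP (size (runs s)); elim: m (runs s) => // m IH [|X [|Y rs]] //=.
by rewrite !ltnS => szr; rewrite IH // (leq_trans (leqnSn _)).
Qed.

Lemma colored_run s X : X \in runs s -> exists c, all (colored c) X.
Proof.
have [c ss] : exists c, starts c s.
  by case: s => [|y s]; [exists true | exists (is_red y); rewrite /= eqxx].
move: (alternating_runs ss); elim: (runs s) c {ss} => //= Y rs IH c.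
by case/and3P=> _ cY /IH {}IH; rewrite inE => /predU1P[->|/IH //]; exists c.
Qed.

Lemma sub_run s X : X \in runs s -> {subset X <= s}.
Proof. by move=> Xs x xX; rewrite -(flatten_runs s); apply/flattenP; exists X. Qed.

Lemma callan_over_red U k (l : seq symbol * seq symbol) v :
  callan_over U k l -> red v \in l.1 ++ l.2 -> v \in U.
Proof.
case/and3P=> /perm_mem pm _ _; rewrite pm mem_cat.
by case/orP=> /mapP[u uU] // [->].
Qed.

(** Recoloring preserves colors, hence runs. Each run has one color, so monotonicity of [h] on the
    red values that occur keeps it decreasing. *)
Lemma callan_word_recolor c h (s : seq symbol) :
  (forall u v, red u \in s -> red v \in s -> u < v -> h u < h v) ->
  callan_word c s -> callan_word c (map (recolor_red h) s).
Proof.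
move=> hm /andP[ss ds]; apply/andP; split.
  by case: s ss {hm ds} => //= x s; rewrite is_red_recolor.
rewrite (runs_map _ (is_red_recolor h)) all_map; apply/allP=> X Xs /=.
apply: decreasing_map (allP ds X Xs) => x y xX yX.
have [d /allP dX] := colored_run Xs.
have [xs ys] := (sub_run Xs xX, sub_run Xs yX).
have := dX x xX; have := dX y yX; rewrite /colored.
case: x y {xX yX} xs ys => [[] x] [[] y] xs ys /=; last by [].
- by move=> _ _; apply: hm.
- by case: (d).
- by case: (d).
Qed.

Lemma callan_over_recolor U k h l :
  {in U &, {homo h : x y / x < y}} -> callan_over U k l ->
  callan_over (map h U) k (map (recolor_red h) l.1, map (recolor_red h) l.2).
Proof.
move=> hm dl; have [pl h1 h2] := and3P dl; apply/and3P; split => /=.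
- rewrite -map_cat (perm_trans (perm_map _ pl)) // map_cat -!map_comp perm_refl //.
- apply: callan_word_recolor h1 => u v us vs; apply: hm; apply: (callan_over_red dl);
    by rewrite mem_cat ?us ?vs.
- apply: callan_word_recolor h2 => u v us vs; apply: hm; apply: (callan_over_red dl);
    by rewrite mem_cat ?us ?vs orbT.
Qed.

(** Relabelling counts red symbols of [l], and these form [U] up to order; so the relabelling
    function depends on [U] alone and can be inverted by [unrank U]. *)
Lemma relabel_redsE U k l :
  callan_over U k l ->
  relabel_reds l = (map (recolor_red (rank U)) l.1, map (recolor_red (rank U)) l.2).
Proof.
case/and3P=> pl _ _; rewrite /relabel_reds.
have rE v : count (fun y => value y <= v) [seq x <- l.1 ++ l.2 | is_red x] = rank U v.
  rewrite count_filter (permP pl) count_cat !count_map [X in _ + X](_ : _ = 0).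
    by rewrite addn0; apply: eq_count => y /=; rewrite andbT.
  by rewrite -[RHS](count_pred0 (iota 1 k)); apply: eq_count => y /=; rewrite andbF.
by congr (_, _); apply: eq_map => x; rewrite /recolor_red rE.
Qed.

Lemma rank_homo U : {in U &, {homo rank U : x y / x < y}}.
Proof.
move=> x y xU yU xy; rewrite /rank.
have -> : count (fun z => z <= y) U
    = count (fun z => z <= x) U + count (fun z => x < z <= y) U.
  rewrite -count_predUI [X in _ + X](_ : _ = 0) ?addn0.
    apply: eq_count => z /=; lia.
  rewrite -[RHS](count_pred0 U); apply: eq_count => z /=; lia.
(* The half-open interval from [x] to [y] contains [y], an element of [U]. *)
rewrite -[X in X < _]addn0 ltn_add2l -has_count; apply/hasP; exists y => //.
by rewrite xy leqnn.
Qed.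

Lemma unrank_homo U :
  sorted ltn U -> {in iota 1 (size U) &, {homo unrank U : x y / x < y}}.
Proof.
move=> sU i j; rewrite !mem_iota => /andP[i1 iU] /andP[j1 jU] ij.
rewrite /unrank; apply: (sorted_ltn_nth ltn_trans) => //; rewrite ?inE; lia.
Qed.

Lemma relabel_ok U k l :
  sorted ltn U -> callan_over U k l -> callan_over (iota 1 (size U)) k (relabel_reds l).
Proof.
move=> sU dl; rewrite (relabel_redsE dl) -(map_rank sU).
exact: callan_over_recolor (@rank_homo U) dl.
Qed.

Lemma recolor_redK U h h' k l :
  {in U, forall v, h' (h v) = v} -> callan_over U k l ->
  (map (recolor_red h') (map (recolor_red h) l.1),
   map (recolor_red h') (map (recolor_red h) l.2)) = l.
Proof.
move=> hK dl; rewrite -!map_comp [RHS]surjective_pairing; congr (_, _).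
  rewrite -[RHS]map_id; apply/eq_in_map=> -[[] x] xl //=; congr (_, _); apply: hK.
  by apply: (callan_over_red dl); rewrite mem_cat xl.
rewrite -[RHS]map_id; apply/eq_in_map=> -[[] x] xl //=; congr (_, _); apply: hK.
by apply: (callan_over_red dl); rewrite mem_cat xl orbT.
Qed.

Lemma relabel_inj U k l1 l2 :
  sorted ltn U -> callan_over U k l1 -> callan_over U k l2 ->
  relabel_reds l1 = relabel_reds l2 -> l1 = l2.
Proof.
move=> sU d1 d2; rewrite (relabel_redsE d1) (relabel_redsE d2) => -[E1 E2].
have hK : {in U, forall v, unrank U (rank U v) = v} by move=> v; apply: rankK.
by rewrite -(recolor_redK hK d1) -(recolor_redK hK d2) E1 E2.
Qed.

Lemma relabel_surj U k l' :
  sorted ltn U -> callan_over (iota 1 (size U)) k l' ->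
  exists2 l, callan_over U k l & relabel_reds l = l'.
Proof.
move=> sU d'; have d := callan_over_recolor (unrank_homo sU) d'.
rewrite map_unrank in d; eexists; first exact: d.
rewrite (relabel_redsE d); apply: recolor_redK d'.
by move=> i; apply: unrankK.
Qed.

(** * Removing the largest blue symbol *)

Lemma decreasing_pairwise X :
  decreasing X = pairwise (fun x y => value y < value x) X.
Proof.
by rewrite /decreasing sorted_pairwise // => x y z; rewrite /value; lia.
Qed.

Lemma decreasing_cons x X :
  decreasing (x :: X) = all (fun y => value y < value x) X && decreasing X.
Proof. by rewrite !decreasing_pairwise. Qed.

Lemma decreasing_rcons x X :
  decreasing (rcons X x) = all (fun y => value x < value y) X && decreasing X.
Proof. by rewrite !decreasing_pairwise pairwise_rcons. Qed.

Lemma colored_block_cons c x X :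
  colored_block c (x :: X)
    = [&& is_red x == c, all (fun y => value y < value x) X & colored_block c X].
Proof. by rewrite /colored_block decreasing_cons /= -andbA; congr (_ && _);
  rewrite andbCA. Qed.

Lemma colored_block_rcons c x X :
  colored_block c (rcons X x)
    = [&& is_red x == c, all (fun y => value x < value y) X & colored_block c X].
Proof.
by rewrite /colored_block decreasing_rcons all_rcons -andbA; congr (_ && _);
  rewrite andbCA.
Qed.

Lemma max_first c x X :
  colored_block c X -> x \in X -> {in X, forall y, value y <= value x} ->
  exists X', X = x :: X'.
Proof.
case: X => // y X; rewrite colored_block_cons => /and3P[_ /allP lty _].
rewrite inE => /predU1P[-> _|xX /(_ y (mem_head _ _))]; first by exists X.
by rewrite leqNgt lty.
Qed.

(** A decreasing block ends at its minimum and no value is below 0. The marker thus has a forced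
    place, which is why marked blocks are written [rcons R0 (red 0)] below. *)
Lemma zero_last X : colored_block true X -> red 0 \in X -> exists X', X = rcons X'
  (red 0).
Proof.
case/lastP: X => // X [c v]; rewrite colored_block_rcons =>
  /and3P[/eqP /= -> /allP ltv _].
rewrite mem_rcons inE => /predU1P[[->]|/ltv //].
by exists X.
Qed.

Lemma sort_decreasing X :
  decreasing X -> sort (fun x y => value y <= value x) X = X.
Proof.
move=> dX; apply: sorted_sort; first by move=> x y z; rewrite /value; lia.
by apply: sub_sorted dX => x y /ltnW.
Qed.

Lemma merge_runs_cat c X s :
  X != [::] -> all (colored c) X -> starts (~~ c) s ->
  merge_runs (X ++ s) = sort (fun x y => value y <= value x) X ++ merge_runs s.
Proof. by move=> X0 cX ss; rewrite /merge_runs (runs_cat X0 cX ss). Qed.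

Lemma merge_runs_word c s : callan_word c s -> merge_runs s = s.
Proof.
case/andP=> _ /allP ds; rewrite /merge_runs -[RHS]flatten_runs; congr flatten.
by rewrite -[RHS]map_id; apply/eq_in_map => X /ds; apply: sort_decreasing.
Qed.

Lemma starts_assemble_cat c ps s :
  all (proper_pair c) ps -> starts c s -> starts c (assemble ps s).
Proof.
case: ps => [|p ps] //= /andP[/andP[H _] _] _.
by rewrite assemble_cons; apply: starts_proper_block.
Qed.

(** Applied with [s] beginning at the marker: the pairs before it are already sorted, and only the
    tail remains to be computed. *)
Lemma merge_runs_assemble c ps s :
  all (proper_pair c) ps -> starts c s ->
  merge_runs (assemble ps s) = assemble ps (merge_runs s).
Proof.
move=> + ss; elim: ps => [|p ps IH] //= /andP[/andP[H1 H2] Hps].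
have [n1 /andP[c1 d1]] := andP H1; have [n2 /andP[c2 d2]] := andP H2.
rewrite !assemble_cons (merge_runs_cat n1 c1) ?(merge_runs_cat n2 c2).
- by rewrite IH // !sort_decreasing.
- by rewrite negbK; apply: starts_assemble_cat.
- exact: starts_proper_block.
Qed.

(** In the second word the marker stands in front of the red block that it joins, so sorting moves
    it from the first to the last place. In the first word it already stands behind that block. *)
Lemma sort_zero_cons X :
  colored_block true (rcons X (red 0)) ->
  sort (fun x y => value y <= value x) (red 0 :: X) = rcons X (red 0).
Proof.
case/andP=> /allP cX dX.
have tr : transitive (fun x y : symbol => value y <= value x).
  by move=> x y z; rewrite /value; lia.
have to : total (fun x y : symbol => value y <= value x).
  by move=> x y; rewrite /value; lia.
have pe : perm_eq (sort (fun x y => value y <= value x) (red 0 :: X)) (rcons X (red 0)).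
  by rewrite perm_sort perm_sym perm_rcons.
(* Comparison by value is antisymmetric only among symbols of one color, hence the uniqueness of
   sorting relative to the elements of the list. *)
apply: (@sorted_eq_in _ (fun x y : symbol => value y <= value x)) pe.
- by move=> x y z _ _ _; apply: tr.
- move=> x y; rewrite !mem_sort -!(mem_rcons) => /cX /eqP xr /cX /eqP yr.
  by case: x y xr yr => [c1 v] [c2 w] /= -> -> /andP[? ?]; congr (_, _); lia.
- exact: sort_sorted.
- by apply: sub_sorted dX => x y /ltnW.
Qed.

(** * Minima of blocks and records of sequences *)

Lemma block_min_le B x : x \in B -> block_min B <= value x.
Proof.
rewrite /block_min; move: (value _) => v.
elim: B => // y B IH; rewrite big_cons inE => /predU1P[->|/IH]; lia.
Qed.

Lemma block_minE B x :
  x \in B -> {in B, forall y, value x <= value y} -> block_min B = value x.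
Proof.
move=> xB lex; apply/eqP; rewrite eqn_leq block_min_le //= /block_min.
case: B xB lex => // y B _ lex /=; rewrite big_seq.
elim/big_ind: _ => [|u v|z /lex //]; first exact/lex/mem_head.
by rewrite leq_min => -> ->.
Qed.

Lemma block_minP B :
  B != [::] ->
  exists2 x, x \in B & block_min B = value x /\ {in B, forall y, value x <= value y}.
Proof.
move=> B0; suff [x xB lex] : exists2 x, x \in B & {in B, forall y, value x <= value y}.
  by exists x => //; split=> //; apply: block_minE.
elim: B B0 => // y [_ _|z B /(_ isT) [x xB lex] _].
  by exists y; rewrite ?inE // => u; rewrite inE => /eqP->.
have [xy|/ltnW yx] := leqP (value x) (value y).
  by exists x => [|u]; rewrite inE ?xB ?orbT // => /predU1P[->//|/lex].
exists y => [|u]; rewrite inE ?eqxx // => /predU1P[->//|/lex].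
exact: leq_trans.
Qed.

(* The number of records (new strict minima) below [m] in the initial part of
   [s] that precedes the first 0; in the column numbers of left arrows of a
   tableau, 0 stands for a row without left arrow. *)
Fixpoint records (m : nat) (s : seq nat) : nat :=
  if s is x :: s' then
    if x == 0 then 0 else if x < m then (records x s').+1 else records m s'
  else 0.

(** An entry not below the current threshold neither counts nor changes later comparisons; being
    positive, it does not cut the sequence off either. *)
Lemma records_skip m x s1 s2 :
  0 < x -> m <= x -> records m (s1 ++ x :: s2) = records m (s1 ++ s2).
Proof.
move=> x0; elim: s1 m => [|y s1 IH] m mx /=.
  by rewrite eqn0Ngt x0 ltnNge mx.
case: eqP => // _; case: ltnP => [ym|_]; last exact: IH.
by rewrite IH // ltnW // (leq_trans ym).
Qed.

(** The first entry, unless it is 0, replaces the threshold, so all thresholds above every entry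
    give the same count. *)
Lemma records_bound m m' s :
  all (fun x => x < m) s -> m <= m' -> records m' s = records m s.
Proof.
case: s => // x s /= /andP[xm _] mm'; case: eqP => // _.
by rewrite xm (leq_trans xm).
Qed.

Definition block_minima (l : seq symbol * seq symbol) : seq nat :=
  [seq block_min p.1 | p <- callan_pairs l.1].

(** * The table of local shapes around the largest blue symbol *)

Notation word_pair := (seq symbol * seq symbol)%type.

Variant move_kind := InExtra | NewFirst | Merged.

(* [step k kd R l0 l]: the unrelabelled image under phi of [l] is [l0], and [R]
   is the deleted red partner of (k+1)^b.  [InExtra], [NewFirst] and [Merged] are
   the cases (1), (2) and (3) of phi; the constructors of the last kind
   distinguish the position of the marker 0^r in [l0]. *)
Variant step (k : nat) : move_kind -> block -> word_pair -> word_pair -> Prop :=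
| StepExtra ps1 e1 s2 of
    all (proper_pair false) ps1 & colored_block false (blue k.+1 :: e1)
    & callan_word true s2 :
    step k InExtra [::] (assemble ps1 e1, s2) (assemble ps1 (blue k.+1 :: e1), s2)
| StepFirst R ps1 e1 s2 of
    proper_block true R & all (proper_pair false) ps1 & colored_block false e1
    & callan_word true s2 :
    step k NewFirst R (assemble ps1 e1, s2)
      (assemble (([:: blue k.+1], R) :: ps1) e1, s2)
| StepLeft1 R x B y e1 s2 of
    proper_block true R & all (proper_pair false) x & all (proper_pair false) y
    & colored_block false e1 & callan_word true s2 & B != [::]
    & colored_block false (blue k.+1 :: B) :
    step k Merged R
      (assemble (x ++ (B, [:: red 0]) :: y) e1, s2)
      (assemble (x ++ (blue k.+1 :: B, R) :: y) e1, s2)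
| StepLeft2 R x B R0 y e1 s2 of
    proper_block true R & all (proper_pair false) x & all (proper_pair false) y
    & colored_block false e1 & callan_word true s2 & proper_block false B
    & R0 != [::] & colored_block true (rcons R0 (red 0)) :
    step k Merged R
      (assemble (x ++ (B, rcons R0 (red 0)) :: y) e1, s2)
      (assemble (x ++ (B, R0) :: ([:: blue k.+1], R) :: y) e1, s2)
| StepRight1 R ps1 e1 x B y e2 of
    proper_block true R & all (proper_pair true) x & all (proper_pair true) y
    & colored_block true e2 & all (proper_pair false) ps1 & colored_block false e1
    & B != [::] & colored_block false (blue k.+1 :: B) :
    step k Merged R
      (assemble ps1 e1, assemble (x ++ ([:: red 0], B) :: y) e2)
      (assemble ps1 e1, assemble (x ++ (R, blue k.+1 :: B) :: y) e2)
| StepRight2 R ps1 e1 x B R0 y e2 of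
    proper_block true R & all (proper_pair true) x & all (proper_pair true) y
    & colored_block true e2 & all (proper_pair false) ps1 & colored_block false e1
    & proper_block false B & R0 != [::] & colored_block true (rcons R0 (red 0)) :
    step k Merged R
      (assemble ps1 e1, assemble (x ++ (rcons R0 (red 0), B) :: y) e2)
      (assemble ps1 e1, assemble (x ++ (R, [:: blue k.+1]) :: (R0, B) :: y) e2)
| StepRight3 R ps1 e1 x R0 of
    proper_block true R & all (proper_pair true) x & all (proper_pair false) ps1
    & colored_block false e1 & colored_block true (rcons R0 (red 0)) :
    step k Merged R
      (assemble ps1 e1, assemble x (rcons R0 (red 0)))
      (assemble ps1 e1, assemble (x ++ [:: (R, [:: blue k.+1])]) R0).

Lemma colored_block1 c x : colored_block c [:: x] = (is_red x == c).
Proof. by rewrite colored_block_cons /= andbT. Qed.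

Lemma colored_block_behead c x X : colored_block c (x :: X) -> colored_block c X.
Proof. by rewrite colored_block_cons => /and3P[]. Qed.

Lemma colored_block_belast c x X : colored_block c (rcons X x) -> colored_block c X.
Proof. by rewrite colored_block_rcons => /and3P[]. Qed.

Lemma step_words k kd R l0 l :
  step k kd R l0 l ->
  [/\ callan_word false l0.1, callan_word true l0.2,
      callan_word false l.1 & callan_word true l.2].
Proof.
case=> *; split=> //=; apply: callan_word_assemble;
  rewrite ?all_cat /= ?all_cat /= /proper_pair /proper_block /= ?colored_block1 //;
  (* Every block containing (k+1)^b or the marker also yields the block without it; all remaining
     conditions are then among the hypotheses, up to the nonemptiness of [rcons R0 (red 0)]. *)
  repeat match goal with
  | H : is_true (colored_block _ (_ :: _)) |- _ =>
      have := colored_block_behead H; move: H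
  | H : is_true (colored_block _ (rcons _ _)) |- _ => have := colored_block_belast H;
    move: H
  | H : is_true (all _ _) |- _ => move: H
  | H : is_true (_ != _) |- _ => move: H
  | H : is_true (proper_block _ _) |- _ => move/andP: H => []
  end.
all: repeat (move=> -> || move=> _); rewrite ?andbT //.
all: by rewrite -size_eq0 size_rcons.
Qed.

(** The marker is put on the side of [l], so that the balance of symbols is an equality of sums and
    every consequence is linear arithmetic on counts. *)
Lemma step_perm k kd R l0 l :
  step k kd R l0 l ->
  perm_eq (nseq (if kd is Merged then 1 else 0) (red 0) ++ l.1 ++ l.2)
          (blue k.+1 :: R ++ l0.1 ++ l0.2).
Proof.
case=> *; apply/permP => a; rewrite /assemble ?map_cat ?flatten_cat /= -?cats1.
all: rewrite !count_cat /= ?count_cat /=; lia.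
Qed.

(** The red half of the balance in [step_perm]: [U0] is [U] without the values of [R], with 0 added
    in case (3). *)
Definition reds_split (kd : move_kind) (U : seq nat) (R : block) (U0 : seq nat) :
  Prop :=
  perm_eq (nseq (if kd is Merged then 1 else 0) (red 0) ++ map red U)
          (R ++ map red U0).

Lemma iota_blue k :
  perm_eq (map blue (iota 1 k.+1)) (blue k.+1 :: map blue (iota 1 k)).
Proof.
have -> : iota 1 k.+1 = iota 1 k ++ [:: k.+1] by rewrite -(addn1 k) iotaD add1n addn1.
by rewrite map_cat /= perm_catC.
Qed.

Lemma step_dcallan k kd R U U0 l0 l :
  step k kd R l0 l -> reds_split kd U R U0 ->
  callan_over U k.+1 l = callan_over U0 k l0.
Proof.
move=> st rs; have [w1 w2 w3 w4] := step_words st.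
rewrite /callan_over w1 w2 w3 w4 !andbT.
move/permP: (step_perm st) => P; move/permP: rs => Q; move/permP: (iota_blue k) => I.
apply/permP/permP => H a; have := H a; have := P a; have := Q a; have := I a;
  rewrite !count_cat /= !count_cat; lia.
Qed.

Lemma callan_over_blue U k l v :
  callan_over U k l -> blue v \in l.1 ++ l.2 -> 0 < v <= k.
Proof.
case/and3P=> /perm_mem pm _ _; rewrite pm mem_cat.
case/orP=> /mapP[u] // + [->]; rewrite mem_iota; lia.
Qed.

Lemma blue_notin U k l : callan_over U k l -> blue k.+1 \notin l.1 ++ l.2.
Proof. by move=> dl; apply/negP => /(callan_over_blue dl); rewrite ltnn andbF. Qed.

Lemma red0_notin U k l : 0 \notin U -> callan_over U k l -> red 0 \notin l.1 ++ l.2.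
Proof. by move=> U0 dl; apply: contra U0 => /(callan_over_red dl). Qed.

(** * Evaluating phi on each shape *)

Definition avoids (x : symbol) (ps : seq block_pair) : bool :=
  all (fun p => (x \notin p.1) && (x \notin p.2)) ps.

Lemma notin_assemble x ps e :
  (x \notin assemble ps e) = avoids x ps && (x \notin e).
Proof.
elim: ps => [|p ps IH]; first by rewrite /assemble /=.
by rewrite assemble_cons mem_cat [_ \in p.2 ++ _]mem_cat !negb_or IH /= !andbA.
Qed.

Lemma map_avoids x ps (f : block_pair -> block_pair) :
  (forall p, x \notin p.1 -> x \notin p.2 -> f p = p) -> avoids x ps -> map f ps = ps.
Proof.
move=> fE /allP av; rewrite -[RHS]map_id; apply/eq_in_map => p /av /andP[].
exact: fE.
Qed.

Lemma filter_avoids x ps (a : pred block_pair) :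
  (forall p, x \notin p.1 -> x \notin p.2 -> a p = false) -> avoids x ps ->
  filter a ps = [::].
Proof.
move=> aE /allP av; rewrite -(filter_pred0 ps); apply/eq_in_filter => p /av /andP[].
exact: aE.
Qed.

Lemma rem_cat_notin (x : symbol) s t : x \notin s -> rem x (s ++ x :: t) = s ++ t.
Proof.
elim: s => [|y s IH] /=; first by rewrite eqxx.
by rewrite inE negb_or eq_sym => /andP[/negPf-> /IH ->].
Qed.

Lemma colored_notin c x X : all (colored c) X -> is_red x != c -> x \notin X.
Proof. by move=> /allP cX; apply: contra => /cX. Qed.

Lemma colored_block_notin c x X : colored_block c X -> is_red x != c -> x \notin X.
Proof. by case/andP=> cX _; apply: colored_notin cX. Qed.

Lemma proper_block_notin c x X : proper_block c X -> is_red x != c -> x \notin X.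
Proof. by case/andP=> _; apply: colored_block_notin. Qed.

(** [phi] before relabelling, the form in which it can be compared with [step]. *)
Definition delete_max (k : nat) (l : word_pair) : word_pair :=
  if in_case1 k l then (rem (blue k) l.1, l.2)
  else if in_case2 k l then
    (assemble (behead (callan_pairs l.1)) (extra_block l.1), l.2)
  else
    (merge_runs (assemble
       [seq if blue k \in p.1 then (rem (blue k) p.1, [:: red 0]) else p
          | p <- callan_pairs l.1] (extra_block l.1)),
     merge_runs (assemble
       [seq if blue k \in p.2 then ([:: red 0], rem (blue k) p.2) else p
          | p <- callan_pairs l.2] (extra_block l.2))).

Lemma phiE k l : phi k l = relabel_reds (delete_max k l).
Proof. by []. Qed.

Definition step_view k kd R (l0 l : word_pair) : Prop :=
  [/\ delete_max k.+1 l = l0,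
      in_case1 k.+1 l = (if kd is InExtra then true else false),
      in_case2 k.+1 l = (if kd is NewFirst then true else false)
    & kd <> InExtra -> red_partner k.+1 l = R].

Lemma map_left_avoids K ps Z :
  avoids K ps ->
  [seq if K \in p.1 then (rem K p.1, Z) else p | p : block_pair <- ps] = ps.
Proof. by apply: map_avoids => p /negPf->. Qed.

Lemma map_right_avoids K ps Z :
  avoids K ps ->
  [seq if K \in p.2 then (Z, rem K p.2) else p | p : block_pair <- ps] = ps.
Proof. by apply: map_avoids => p _ /negPf->. Qed.

Lemma filter_left_avoids K ps :
  avoids K ps -> [seq p : block_pair <- ps | K \in p.1] = [::].
Proof. by apply: filter_avoids => p /negPf->. Qed.

Lemma filter_right_avoids K ps :
  avoids K ps -> [seq p : block_pair <- ps | K \in p.2] = [::].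
Proof. by apply: filter_avoids => p _ /negPf->. Qed.

(** Case (2) concerns the very first pair only, so a nonempty prefix that avoids k^b rules it
    out. *)
Lemma head_avoids K x (y : seq block_pair) :
  avoids K x ->
  (if x ++ y is (B, _) :: _ then B == [:: K] else false)
    = (if x is [::] then if y is (B, _) :: _ then B == [:: K] else false else false).
Proof.
case: x => [|[B Q] x] //= /andP[/andP[KB _] _].
by apply/negbTE; apply: contra KB => /eqP->; rewrite inE.
Qed.

Lemma right_unchanged K s Z :
  callan_word true s -> K \notin s ->
  merge_runs (assemble
     [seq if K \in p.2 then (Z, rem K p.2) else p | p <- callan_pairs s]
     (extra_block s)) = s.
Proof.
move=> ws; have [E ps es] := callan_word_blocks ws.
rewrite {1}E notin_assemble => /andP[Kps _].
by rewrite map_right_avoids // -E (merge_runs_word ws).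
Qed.

(** Since (k+1)^b does not occur in [l0], its displayed occurrence in [l] is the only one, and each
    search made by [phi] or [red_partner] ends at the displayed pair. *)
Lemma step_viewP k kd R l0 l :
  step k kd R l0 l -> blue k.+1 \notin l0.1 ++ l0.2 -> step_view k kd R l0 l.
Proof.
move=> st; have [w1 w2 _ _] := step_words st.
have := merge_runs_word w1; have := merge_runs_word w2; move: w1 w2.
rewrite /step_view /delete_max /in_case1 /in_case2 /red_partner.
case: st => [ps1 e1 s2 p1 q1 h2 | R1 ps1 e1 s2 rR p1 q1 h2
  | R1 x B y e1 s2 rR px py q1 h2 B0 qB
  | R1 x B R0 y e1 s2 rR px py q1 h2 bB R00 qR0
  | R1 ps1 e1 x B y e2 rR px py q2 p1 q1 B0 qB
  | R1 ps1 e1 x B R0 y e2 rR px py q2 p1 q1 bB R00 qR0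
  | R1 ps1 e1 x R0 rR px p1 q1 qR0] /= w1 w2 m2 m1.
- rewrite (callan_pairs_assemble p1 q1) (extra_block_assemble p1 q1) mem_head.
  rewrite mem_cat negb_or notin_assemble => /andP[/andP[Kps _] _].
  have := head_avoids [::] Kps; rewrite cats0 => ->.
  split=> //; last by case: (ps1).
  by rewrite /assemble rem_cat_notin //; have := notin_assemble (blue k.+1) ps1 [::];
    rewrite /assemble cats0 Kps => ->.
- have pK : all (proper_pair false) (([:: blue k.+1], R1) :: ps1).
    by rewrite /= /proper_pair /proper_block colored_block1 /= -/(proper_block true
      R1) rR.
  rewrite (callan_pairs_assemble pK q1) (extra_block_assemble pK q1) /=.
  rewrite mem_cat negb_or notin_assemble => /andP[/andP[Kps /negPf->] _].
  by rewrite eqxx inE eqxx.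
- have pK : all (proper_pair false) (x ++ (blue k.+1 :: B, R1) :: y).
    by rewrite all_cat px /= py /proper_pair /proper_block /= qB -/(proper_block true
      R1) rR.
  rewrite (callan_pairs_assemble pK q1) (extra_block_assemble pK q1) /=.
  rewrite mem_cat negb_or notin_assemble /avoids all_cat /=.
  case/andP=> /andP[/and3P[Kx /andP[KB _] Ky] Ke1] Ks2.
  rewrite (negPf Ke1) (head_avoids _ Kx).
  rewrite (_ : (if x is [::] then _ else _) = false); last first.
    by case: (x) => //; rewrite eqseq_cons eqxx /= (negPf B0).
  split=> //; last by rewrite filter_cat filter_left_avoids //= mem_head.
  rewrite right_unchanged // map_cat /= mem_head eqxx !map_left_avoids //.
  by rewrite m1.
- have bR0 : proper_block true R0 by rewrite /proper_block R00 (colored_block_belast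
  qR0).
  have pK : all (proper_pair false) (x ++ (B, R0) :: ([:: blue k.+1], R1) :: y).
    by rewrite all_cat px /= py /proper_pair /= bB bR0 rR.
  rewrite (callan_pairs_assemble pK q1) (extra_block_assemble pK q1) /=.
  rewrite mem_cat negb_or notin_assemble /avoids all_cat /=.
  case/andP=> /andP[/and3P[Kx /andP[KB _] Ky] Ke1] Ks2.
  rewrite (negPf Ke1) (head_avoids _ Kx).
  rewrite (_ : (if x is [::] then _ else _) = false); last first.
    by case: (x) => //; apply/negbTE; apply: contra KB => /eqP->; rewrite inE.
  split=> //; last first.
    by rewrite filter_cat filter_left_avoids //= (negPf KB) mem_head.
  rewrite right_unchanged // map_cat /= (negPf KB) mem_head eqxx !map_left_avoids //.
  (* The emptied blue block leaves [R0] directly followed by the marker, which is the word of [l0]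
     up to associativity; [m1] says that it is already merged. *)
  move: m1; rewrite !assemble_cat !assemble_cons /= -cats1 -!catA /=.
  by move->.
- have pK : all (proper_pair true) (x ++ (R1, blue k.+1 :: B) :: y).
    by rewrite all_cat px /= py /proper_pair /= rR /proper_block /= qB.
  rewrite (callan_pairs_assemble pK q2) (extra_block_assemble pK q2) /=.
  rewrite (callan_pairs_assemble p1 q1) (extra_block_assemble p1 q1) /=.
  rewrite mem_cat negb_or !notin_assemble /avoids all_cat /=.
  case/andP=> /andP[Kps Ke1] /andP[/and3P[Kx KB Ky] Ke2].
  have := head_avoids [::] Kps; rewrite cats0 => ->; rewrite (negPf Ke1).
  rewrite (_ : (if ps1 is [::] then _ else _) = false); last by case: (ps1).
  split=> //; last first.
    by rewrite filter_left_avoids // filter_cat filter_right_avoids //= mem_head.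
  by rewrite !map_left_avoids // m1 map_cat /= mem_head eqxx !map_right_avoids // m2.
- have bR0 : proper_block true R0 by rewrite /proper_block R00 (colored_block_belast
  qR0).
  have pK : all (proper_pair true) (x ++ (R1, [:: blue k.+1]) :: (R0, B) :: y).
    by rewrite all_cat px /= py /proper_pair /= bB bR0 rR.
  rewrite (callan_pairs_assemble pK q2) (extra_block_assemble pK q2) /=.
  rewrite (callan_pairs_assemble p1 q1) (extra_block_assemble p1 q1) /=.
  rewrite mem_cat negb_or !notin_assemble /avoids all_cat /=.
  case/andP=> /andP[Kps Ke1] /andP[/and3P[Kx /andP[_ KB] Ky] Ke2].
  have := head_avoids [::] Kps; rewrite cats0 => ->; rewrite (negPf Ke1).
  rewrite (_ : (if ps1 is [::] then _ else _) = false); last by case: (ps1).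
  split=> //; last first.
    by rewrite filter_left_avoids // filter_cat filter_right_avoids //= mem_head.
  rewrite !map_left_avoids // m1 map_cat /= mem_head eqxx (negPf KB)
    !map_right_avoids //.
  (* Here the marker precedes [R0], so the run [red 0 :: R0] really has to be sorted. *)
  congr (_, _); rewrite !assemble_cat !assemble_cons /= (merge_runs_assemble px) //.
  have [cR _] := andP (colored_block_belast qR0).
  have sB : starts false (B ++ assemble y e2) by apply: starts_proper_block.
  rewrite -cat_cons (@merge_runs_cat true) //= sort_zero_cons //.
  have [nB /andP[cB dB]] := andP bB.
  rewrite (merge_runs_cat nB cB) ?starts_assemble // sort_decreasing //.
  by rewrite (merge_runs_word (callan_word_assemble py q2)).
- have qR := colored_block_belast qR0.
  have pK : all (proper_pair true) (x ++ [:: (R1, [:: blue k.+1])]).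
    by rewrite all_cat px /= /proper_pair /= rR.
  rewrite (callan_pairs_assemble pK qR) (extra_block_assemble pK qR) /=.
  rewrite (callan_pairs_assemble p1 q1) (extra_block_assemble p1 q1) /=.
  rewrite mem_cat negb_or !notin_assemble => /andP[/andP[Kps Ke1] /andP[Kx _]].
  have := head_avoids [::] Kps; rewrite cats0 => ->; rewrite (negPf Ke1).
  rewrite (_ : (if ps1 is [::] then _ else _) = false); last by case: (ps1).
  split=> //; last first.
    by rewrite filter_left_avoids // filter_cat filter_right_avoids //= mem_head.
  rewrite !map_left_avoids // m1 map_cat /= mem_head eqxx !map_right_avoids //.
  congr (_, _); rewrite !assemble_cat !assemble_cons /= (merge_runs_assemble px) //.
  have [cR _] := andP qR.
  by rewrite /assemble /= -[red 0 :: R0]cats0 (@merge_runs_cat true) //=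
    sort_zero_cons // cats0.
Qed.

(** * Records under a step, and the inverse rule *)

Lemma minima_bound U k l :
  callan_over U k l -> all (fun m => 0 < m <= k) (block_minima l).
Proof.
move=> dl; have [_ w1 _] := and3P dl; have [E ps _] := callan_word_blocks w1.
apply/allP => m /mapP[p pl ->].
have /andP[bp _] := allP ps p pl; have /andP[p0 /andP[/allP cp _]] := bp.
have [x xp [-> _]] := block_minP p0.
have xb : x = blue (value x) by have := cp x xp; case: (x) => [[]].
apply: (callan_over_blue dl); rewrite -xb mem_cat E; apply/orP; left.
by rewrite /assemble mem_cat; apply/orP; left; apply/flattenP;
  exists (p.1 ++ p.2); [apply/mapP; exists p | rewrite mem_cat xp].
Qed.

Lemma block_min_cons x B :
  B != [::] -> decreasing (x :: B) -> block_min (x :: B) = block_min B.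
Proof.
rewrite decreasing_cons => B0 /andP[/allP ltx _].
have [y yB [-> ley]] := block_minP B0; apply: block_minE; first by rewrite inE yB orbT.
by move=> z; rewrite inE => /predU1P[->|/ley //]; apply/ltnW/ltx.
Qed.

Lemma block_min1 x : block_min [:: x] = value x.
Proof. by apply: block_minE => [|u]; rewrite inE // => /eqP->. Qed.

(** With threshold k+2 the value k+1 would be a record in first position; a nonempty [s1] lowers the
    threshold before it is reached. *)
Lemma records_skip_max k s1 s2 :
  s1 != [::] -> all (fun m => 0 < m <= k) s1 ->
  records k.+2 (s1 ++ k.+1 :: s2) = records k.+2 (s1 ++ s2).
Proof.
case: s1 => //= x s1 _ /andP[/andP[x0 xk] _].
by case: eqP => // _; rewrite ltnS (leqW xk) records_skip // leqW.
Qed.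

(** In a larger block k+1 is not the minimum; alone in a block behind another pair it exceeds an
    earlier minimum; alone in the first block it is a record, and it lies above all other minima, so
    it hides none of them. *)
Lemma step_records U0 k kd R l0 l :
  step k kd R l0 l -> callan_over U0 k l0 ->
  records k.+2 (block_minima l)
    = records k.+1 (block_minima l0) + (if kd is NewFirst then 1 else 0).
Proof.
move=> st d0; have b0 := minima_bound d0.
have <- : records k.+2 (block_minima l0) = records k.+1 (block_minima l0).
  by apply: records_bound => //; apply: sub_all b0 => m /andP[_]; rewrite ltnS.
have [w1 _ _ _] := step_words st; move: b0 {d0} w1; rewrite /block_minima.
case: st => [ps1 e1 s2 p1 q1 h2 | R1 ps1 e1 s2 rR p1 q1 h2
  | R1 x B y e1 s2 rR px py q1 h2 B0 qB
  | R1 x B R0 y e1 s2 rR px py q1 h2 bB R00 qR0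
  | R1 ps1 e1 x B y e2 rR px py q2 p1 q1 B0 qB
  | R1 ps1 e1 x B R0 y e2 rR px py q2 p1 q1 bB R00 qR0
  | R1 ps1 e1 x R0 rR px p1 q1 qR0] /= b0 w1; rewrite ?addn0 //.
- by rewrite (callan_pairs_assemble p1 q1) (callan_pairs_assemble p1
  (colored_block_behead q1)).
- have pK : all (proper_pair false) (([:: blue k.+1], R1) :: ps1) by rewrite /=
  /proper_pair /= rR.
  rewrite (callan_pairs_assemble p1 q1) in b0 *.
  rewrite (callan_pairs_assemble pK q1) /= block_min1 /= ltnSn addn1.
  rewrite -(@records_bound k.+1 k.+2) //.
  by apply: sub_all b0 => m /andP[_]; rewrite ltnS.
- have pK : all (proper_pair false) (x ++ (blue k.+1 :: B, R1) :: y).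
    by rewrite all_cat px /= py /proper_pair /proper_block /= qB -/(proper_block true
      R1) rR.
  have p0 : all (proper_pair false) (x ++ (B, [:: red 0]) :: y).
    by rewrite all_cat px /= py /proper_pair /proper_block /= B0
      (colored_block_behead qB).
  rewrite (callan_pairs_assemble pK q1) (callan_pairs_assemble p0 q1) !map_cat /=.
  by rewrite block_min_cons //; case/andP: qB.
- have bR0 : proper_block true R0 by rewrite /proper_block R00 (colored_block_belast
  qR0).
  have pK : all (proper_pair false) (x ++ (B, R0) :: ([:: blue k.+1], R1) :: y).
    by rewrite all_cat px /= py /proper_pair /= bB bR0 rR.
  have p0 : all (proper_pair false) (x ++ (B, rcons R0 (red 0)) :: y).
    by rewrite all_cat px /= py /proper_pair /= bB /proper_block qR0 -size_eq0
      size_rcons.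
  rewrite (callan_pairs_assemble p0 q1) in b0 *.
  rewrite (callan_pairs_assemble pK q1) !map_cat /= in b0 *.
  rewrite block_min1 -!(cat_rcons (block_min B)) records_skip_max //;
    first by rewrite -size_eq0 size_rcons.
  by move: b0; rewrite -(cat_rcons (block_min B)) all_cat => /andP[].
Qed.

(* A marker alone in its ordinary block replaced the partner of a blue block that
   survived; otherwise it was absorbed by a neighbouring red block. *)
Definition undo_left k (R : block) (p : block_pair) : seq block_pair :=
  if red 0 \in p.2 then
    if p.2 == [:: red 0] then [:: (blue k.+1 :: p.1, R)]
    else [:: (p.1, rem (red 0) p.2); ([:: blue k.+1], R)]
  else [:: p].

Definition undo_right k (R : block) (p : block_pair) : seq block_pair :=
  if red 0 \in p.1 then
    if p.1 == [:: red 0] then [:: (R, blue k.+1 :: p.2)]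
    else [:: (R, [:: blue k.+1]); (rem (red 0) p.1, p.2)]
  else [:: p].

(** A marker in the extra block of the second word, even a lone one, always stands for a deleted
    pair: no blue block follows it that could have contained (k+1)^b. *)
Definition undo (k : nat) (kd : move_kind) (R : block) (l : word_pair) : word_pair :=
  match kd with
  | InExtra => (assemble (callan_pairs l.1) (blue k.+1 :: extra_block l.1), l.2)
  | NewFirst =>
      (assemble (([:: blue k.+1], R) :: callan_pairs l.1) (extra_block l.1), l.2)
  | Merged =>
      (assemble (flatten (map (undo_left k R) (callan_pairs l.1))) (extra_block l.1),
       assemble (flatten (map (undo_right k R) (callan_pairs l.2))
           ++ (if red 0 \in extra_block l.2 then [:: (R, [:: blue k.+1])] else [::]))
         (rem (red 0) (extra_block l.2)))
  end.

Lemma undo_left_avoids k R ps :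
  avoids (red 0) ps -> flatten (map (undo_left k R) ps) = ps.
Proof.
elim: ps => //= p ps IH /andP[/andP[_ Zp] /IH->].
by rewrite /undo_left (negPf Zp).
Qed.

Lemma undo_right_avoids k R ps :
  avoids (red 0) ps -> flatten (map (undo_right k R) ps) = ps.
Proof.
elim: ps => //= p ps IH /andP[/andP[Zp _] /IH->].
by rewrite /undo_right (negPf Zp).
Qed.

Lemma undo_right_word k R s :
  callan_word true s -> red 0 \notin s ->
  assemble (flatten (map (undo_right k R) (callan_pairs s))
           ++ (if red 0 \in extra_block s then [:: (R, [:: blue k.+1])] else [::]))
         (rem (red 0) (extra_block s)) = s.
Proof.
move=> ws; have [E ps es] := callan_word_blocks ws.
rewrite {1}E notin_assemble => /andP[Zps Ze].
by rewrite undo_right_avoids // (negPf Ze) cats0 rem_id // -E.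
Qed.

Lemma rem_rcons_notin (x : symbol) s : x \notin s -> rem x (rcons s x) = s.
Proof. by move=> xs; rewrite -cats1 rem_cat_notin // cats0. Qed.

Lemma rcons_neq1 (R0 : block) x : R0 != [::] -> (rcons R0 x == [:: x]) = false.
Proof. by case: R0 => [|y [|z R0]] //= _; rewrite eqseq_cons andbF. Qed.

(** As [l] contains no marker, the displayed marker of [l0] is the only one, and the rule changes a
    single place. This is the source of injectivity. *)
Lemma step_undo k kd R l0 l :
  step k kd R l0 l -> red 0 \notin l.1 ++ l.2 -> l = undo k kd R l0.
Proof.
case=> [ps1 e1 s2 p1 q1 h2 | R1 ps1 e1 s2 rR p1 q1 h2
  | R1 x B y e1 s2 rR px py q1 h2 B0 qB
  | R1 x B R0 y e1 s2 rR px py q1 h2 bB R00 qR0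
  | R1 ps1 e1 x B y e2 rR px py q2 p1 q1 B0 qB
  | R1 ps1 e1 x B R0 y e2 rR px py q2 p1 q1 bB R00 qR0
  | R1 ps1 e1 x R0 rR px p1 q1 qR0] /=.
- move=> _; have q := colored_block_behead q1.
  by rewrite (callan_pairs_assemble p1 q) (extra_block_assemble p1 q).
- by rewrite (callan_pairs_assemble p1 q1) (extra_block_assemble p1 q1).
- have p0 : all (proper_pair false) (x ++ (B, [:: red 0]) :: y).
    by rewrite all_cat px /= py /proper_pair /proper_block /= B0
      (colored_block_behead qB).
  rewrite (callan_pairs_assemble p0 q1) (extra_block_assemble p0 q1).
  rewrite mem_cat negb_or notin_assemble /avoids all_cat /=.
  case/andP=> /andP[/and3P[Zx _ Zy] Ze1] Zs2; rewrite undo_right_word //.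
  by rewrite map_cat flatten_cat /= !undo_left_avoids //.
- have p0 : all (proper_pair false) (x ++ (B, rcons R0 (red 0)) :: y).
    by rewrite all_cat px /= py /proper_pair /= bB /proper_block qR0 -size_eq0
      size_rcons.
  rewrite (callan_pairs_assemble p0 q1) (extra_block_assemble p0 q1).
  rewrite mem_cat negb_or notin_assemble /avoids all_cat /=.
  case/andP=> /andP[/and4P[Zx /andP[_ ZR0] _ Zy] Ze1] Zs2; rewrite undo_right_word //.
  rewrite map_cat flatten_cat /= !undo_left_avoids //.
  by rewrite /undo_left /= mem_rcons mem_head rcons_neq1 //= rem_rcons_notin.
- have p0 : all (proper_pair true) (x ++ ([:: red 0], B) :: y).
    by rewrite all_cat px /= py /proper_pair /proper_block /= B0
      (colored_block_behead qB).
  rewrite (callan_pairs_assemble p0 q2) (extra_block_assemble p0 q2).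
  rewrite (callan_pairs_assemble p1 q1) (extra_block_assemble p1 q1).
  rewrite mem_cat negb_or !notin_assemble /avoids all_cat /=.
  case/andP=> /andP[Zps Ze1] /andP[/and3P[Zx _ Zy] Ze2].
  rewrite undo_left_avoids // (negPf Ze2) rem_id // cats0.
  by rewrite map_cat flatten_cat /= !undo_right_avoids //.
- have p0 : all (proper_pair true) (x ++ (rcons R0 (red 0), B) :: y).
    by rewrite all_cat px /= py /proper_pair /= bB /proper_block qR0 -size_eq0
      size_rcons.
  rewrite (callan_pairs_assemble p0 q2) (extra_block_assemble p0 q2).
  rewrite (callan_pairs_assemble p1 q1) (extra_block_assemble p1 q1).
  rewrite mem_cat negb_or !notin_assemble /avoids all_cat /=.
  case/andP=> /andP[Zps Ze1] /andP[/and4P[Zx _ /andP[ZR0 _] Zy] Ze2].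
  rewrite undo_left_avoids // (negPf Ze2) rem_id // cats0.
  rewrite map_cat flatten_cat /= !undo_right_avoids //.
  by rewrite /undo_right /= mem_rcons mem_head rcons_neq1 //= rem_rcons_notin.
- rewrite (callan_pairs_assemble px qR0) (extra_block_assemble px qR0).
  rewrite (callan_pairs_assemble p1 q1) (extra_block_assemble p1 q1).
  rewrite mem_cat negb_or !notin_assemble /avoids all_cat /=.
  case/andP=> /andP[Zps Ze1] /andP[/andP[Zx _] ZR0].
  by rewrite undo_left_avoids // undo_right_avoids // mem_rcons mem_head
    rem_rcons_notin.
Qed.

(** * Every permutation occurs on both sides of the table *)

Lemma mem_assemble_pair x p ps e :
  p \in ps -> x \in p.1 ++ p.2 -> x \in assemble ps e.
Proof.
move=> pps xp; rewrite /assemble mem_cat; apply/orP; left; apply/flattenP.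
by exists (p.1 ++ p.2) => //; apply: map_f.
Qed.

Lemma mem_assembleP x ps e :
  x \in assemble ps e ->
  x \in e \/ exists y p z, ps = y ++ p :: z /\ x \in p.1 ++ p.2.
Proof.
rewrite /assemble mem_cat => /orP[/flattenP[_ /mapP[p pps ->] xp]|]; [right|by left].
by case/splitPr: pps => y z; exists y, p, z.
Qed.

Lemma colored_block_cons_max U k l B :
  callan_over U k l -> colored_block false B -> {subset B <= l.1 ++ l.2} ->
  colored_block false (blue k.+1 :: B).
Proof.
move=> dl eB sB; rewrite colored_block_cons eB /= andbT; apply/allP => y yB.
have /andP[/allP cB _] := eB.
have : y \in l.1 ++ l.2 by apply: sB.
case: y yB => [[] v] yB; first by have := cB _ yB.
by move/(callan_over_blue dl) => /andP[_]; rewrite /value ltnS.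
Qed.

Lemma colored_block_rcons_zero U k l X :
  0 \notin U -> callan_over U k l -> colored_block true X -> {subset X <= l.1 ++ l.2} ->
  colored_block true (rcons X (red 0)).
Proof.
move=> U0 dl eX sX; rewrite colored_block_rcons eX /= andbT; apply/allP => y yX.
have /andP[/allP cX _] := eX.
have : y \in l.1 ++ l.2 by apply: sX.
case: y yX => [[] v] yX; last by have := cX _ yX.
move/(callan_over_red dl) => vU; rewrite /value /= lt0n.
by apply: contra U0 => /eqP<-.
Qed.

Lemma colored_block_max_first U k l B :
  callan_over U k.+1 l -> colored_block false B -> {subset B <= l.1 ++ l.2} -> blue
    k.+1 \in B ->
  exists B', B = blue k.+1 :: B'.
Proof.
move=> dl eB sB KB; apply: (max_first eB) => // y yB.
have /andP[/allP cB _] := eB.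
have : y \in l.1 ++ l.2 by apply: sB.
case: y yB => [[] v] yB; first by have := cB _ yB.
by move/(callan_over_blue dl) => /andP[_].
Qed.

(** In case (3) the block that contains the marker, and whether it contains anything else, selects
    the shape. The extra block of the first word is blue and cannot contain it. *)
Lemma step_from U0 k kd R l0 :
  callan_over U0 k l0 -> (if kd is InExtra then R = [::] else proper_block true R) ->
  (if kd is Merged then 0 \in U0 else true) ->
  exists l, step k kd R l0 l.
Proof.
move=> d0; have := d0; move: d0 => /callan_overP[ps1 e1 ps2 e2 p1 q1 p2 q2 pm] d0.
have w2 := callan_word_assemble p2 q2.
case: kd => [->|rR|rR] U00.
- eexists; apply: StepExtra => //.
  by apply: (colored_block_cons_max d0) => // y ye;
    rewrite /= mem_cat /assemble mem_cat ye orbT.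
- by eexists; apply: StepFirst.
have : red 0 \in assemble ps1 e1 ++ assemble ps2 e2.
  by rewrite (perm_mem pm) mem_cat map_f.
rewrite mem_cat => /orP[] /mem_assembleP[|[x [[X Y] [y [E ]]]]].
- by move=> Ze; have := colored_block_notin q1 (isT : is_red (red 0) != false);
  rewrite Ze.
- rewrite {}E in p1 d0 *; move: p1.
  rewrite all_cat /= => /and3P[px /andP[/= bX bY] py].
  have [X0 eX] := andP bX; have [Y0 eY] := andP bY.
  rewrite mem_cat (negPf (proper_block_notin bX _)) //= => ZY.
  have [R0 ER] := zero_last eY ZY; rewrite {}ER {ZY Y0 bY} in eY d0 *.
  have [->|R00] := eqVneq R0 [::]; last by eexists; apply: StepLeft2.
  eexists; apply: StepLeft1 => //; apply: (colored_block_cons_max d0) => // z zX /=.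
  rewrite mem_cat (@mem_assemble_pair _ (X, rcons R0 (red 0))) //=.
    by rewrite mem_cat mem_head orbT.
  by rewrite mem_cat zX.
- move=> Ze; have [R0 ER] := zero_last q2 Ze; rewrite {}ER in q2 *.
  by eexists; apply: StepRight3.
- rewrite {}E in p2 d0 *; move: p2.
  rewrite all_cat /= => /and3P[px /andP[/= bX bY] py].
  have [X0 eX] := andP bX; have [Y0 eY] := andP bY.
  rewrite mem_cat orbC (negPf (proper_block_notin bY _)) //= => ZX.
  have [R0 ER] := zero_last eX ZX; rewrite {}ER {ZX X0 bX} in eX d0 *.
  have [->|R00] := eqVneq R0 [::]; last by eexists; apply: StepRight2.
  eexists; apply: StepRight1 => //; apply: (colored_block_cons_max d0) => // z zY /=.
  rewrite mem_cat orbC (@mem_assemble_pair _ (rcons R0 (red 0), Y)) //=.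
    by rewrite mem_cat mem_head orbT.
  by rewrite mem_cat zY orbT.
Qed.

Lemma step_onto U k l :
  0 \notin U -> callan_over U k.+1 l ->
  exists kd R l0, step k kd R l0 l /\ (if kd is InExtra then R = [::] else
    proper_block true R).
Proof.
move=> U0 dl; have := dl; move: dl => /callan_overP[ps1 e1 ps2 e2 p1 q1 p2 q2 pm] dl.
have w2 := callan_word_assemble p2 q2.
have : blue k.+1 \in assemble ps1 e1 ++ assemble ps2 e2.
  by rewrite (perm_mem pm) mem_cat orbC map_f // mem_iota; lia.
rewrite mem_cat => /orP[] /mem_assembleP[|[x [[X Y] [y [E ]]]]].
- move=> Ke; have [|e0 Ee] := colored_block_max_first dl q1 _ Ke.
    by move=> y ye; rewrite /= mem_cat /assemble mem_cat ye orbT.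
  rewrite {}Ee in q1 *; exists InExtra, [::]; eexists.
  by split=> //; apply: StepExtra.
- rewrite {}E in p1 dl *; move: p1.
  rewrite all_cat /= => /and3P[px /andP[/= bX bY] py].
  have [X0 eX] := andP bX; have [Y0 eY] := andP bY.
  rewrite mem_cat orbC (negPf (proper_block_notin bY _)) //= => KX.
  have [|B EB] := colored_block_max_first dl eX _ KX.
    move=> z zX; rewrite /= mem_cat (@mem_assemble_pair _ (X, Y)) //=.
      by rewrite mem_cat mem_head orbT.
    by rewrite mem_cat zX.
  rewrite {}EB {KX X0 bX} in eX dl *.
  have [EB|B0] := eqVneq B [::]; last first.
    by exists Merged, Y; eexists; split=> //; apply: StepLeft1.
  (* (k+1)^b is alone in its block: the marker joins the red block of the preceding pair, and if
     there is none this is case (2). *)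
  rewrite {}EB in dl *; case/lastP: x px dl => [|x [B0 R0]] px dl.
    by exists NewFirst, Y; eexists; split=> //; apply: StepFirst.
  move: px; rewrite all_rcons => /andP[/andP[/= bB0 bR0] px].
  rewrite cat_rcons in dl *; exists Merged, Y; eexists; split=> //.
  have [R00 eR0] := andP bR0; apply: StepLeft2 => //.
  apply: (colored_block_rcons_zero U0 dl) => // z zR.
  rewrite mem_cat (@mem_assemble_pair _ (B0, R0)) //=.
    by rewrite mem_cat mem_head orbT.
  by rewrite mem_cat zR orbT.
- by move=> Ke; have := colored_block_notin q2 (isT : is_red (blue k.+1) != true);
  rewrite Ke.
- rewrite {}E in p2 dl *; move: p2.
  rewrite all_cat /= => /and3P[px /andP[/= bX bY] py].
  have [X0 eX] := andP bX; have [Y0 eY] := andP bY.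
  rewrite mem_cat (negPf (proper_block_notin bX _)) //= => KY.
  have [|B EB] := colored_block_max_first dl eY _ KY.
    move=> z zY; rewrite /= mem_cat orbC (@mem_assemble_pair _ (X, Y)) //=.
      by rewrite mem_cat mem_head orbT.
    by rewrite mem_cat zY orbT.
  rewrite {}EB {KY Y0 bY} in eY dl *.
  have [EB|B0] := eqVneq B [::]; last first.
    by exists Merged, X; eexists; split=> //; apply: StepRight1.
  (* In the second word the marker joins the next red block instead: that of the following pair or,
     at the end, the extra block. *)
  rewrite {}EB in dl *; case: y py dl => [_|[R0 B0] y py] dl.
    exists Merged, X; eexists; split=> //; apply: StepRight3 => //.
    apply: (colored_block_rcons_zero U0 dl) => // z zR.
    by rewrite mem_cat orbC /assemble mem_cat zR orbT.
  move: py => /= /andP[/andP[/= bR0 bB0] py].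
  exists Merged, X; eexists; split=> //.
  have [R00 eR0] := andP bR0; apply: StepRight2 => //.
  apply: (colored_block_rcons_zero U0 dl) => // z zR.
  rewrite mem_cat orbC (@mem_assemble_pair _ (R0, B0)) //=.
    by rewrite mem_cat !inE eqxx !orbT.
  by rewrite mem_cat zR.
Qed.

(** * Columns *)

Lemma decreasing_uniq X : decreasing X -> uniq X.
Proof.
by apply: sorted_uniq => [x y z|x]; rewrite /value; lia.
Qed.

Lemma decreasing_eq X Y : decreasing X -> decreasing Y -> X =i Y -> X = Y.
Proof.
by apply: irr_sorted_eq => [x y z|x]; rewrite /value; lia.
Qed.

Definition red_block (n : nat) (R : block) : bool :=
  proper_block true R && all (fun x => value x \in iota 1 n) R.

Definition kind_block (n : nat) (kd : move_kind) (R : block) : Prop :=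
  if kd is InExtra then R = [::] else red_block n R.

Lemma red_blockP n R x : red_block n R -> x \in R -> exists2 r, x = red r & 0 < r <= n.
Proof.
case/andP=> /andP[_ /andP[/allP cR _]] /allP vR xR.
have := cR x xR; have := vR x xR; case: x {xR} => c v /=.
rewrite mem_iota /colored /is_red /= => vn /eqP ->.
by exists v => //; lia.
Qed.

Lemma red_block_max n R :
  red_block n R ->
  [/\ red (block_max R) \in R, 0 < block_max R <= n
    & forall r, red r \in R -> 0 < r <= block_max R].
Proof.
move=> rR; have [/andP[R0 _] _] := andP rR.
have leM x : x \in R -> value x <= block_max R.
  by move=> xR; rewrite /block_max (big_rem x) //= leq_maxl.
have [x xR Ex] : exists2 x, x \in R & block_max R = value x.
  rewrite /block_max; elim: (R) R0 => // x [_ _|y X /(_ isT) [z zX Ez] _].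
    by exists x; rewrite ?mem_head // big_cons big_nil maxn0.
  rewrite big_cons Ez; have [_|_] := leqP (value x) (value z).
    by exists z; rewrite // inE zX orbT.
  by exists x; rewrite ?mem_head.
have [r Er rn] := red_blockP rR xR.
split; [by rewrite Ex Er -Er|by rewrite Ex Er|].
move=> s sR; have [t [Et] tn] := red_blockP rR sR.
by have := leM _ sR; rewrite /value /=; lia.
Qed.

Definition block_of (n : nat) (P : pred nat) : block :=
  map red (rev [seq r <- iota 1 n | P r]).

Lemma mem_block_of n P r : (red r \in block_of n P) = (0 < r <= n) && P r.
Proof.
rewrite mem_map; last by move=> ? ? [].
by rewrite mem_rev mem_filter mem_iota andbC; congr (_ && _); lia.
Qed.

Lemma block_of_ok n P :
  has P (iota 1 n) -> red_block n (block_of n P).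
Proof.
move=> hP; rewrite /red_block /proper_block /colored_block; apply/andP; split.
  apply/andP; split.
    by rewrite -size_eq0 size_map size_rev -lt0n size_filter -has_count.
  apply/andP; split; first by apply/allP => x /mapP[r _ ->].
  rewrite /decreasing sorted_map /relpre /= rev_sorted.
  by apply: sorted_filter (iota_ltn_sorted 1 n); apply: ltn_trans.
apply/allP => x /mapP[r rn ->]; move: rn.
by rewrite mem_rev mem_filter => /andP[].
Qed.

(** The column as a function of the case and of [R] alone, detached from the permutation. *)
Definition column (kd : move_kind) (R : block) (r : nat) : cell :=
  match kd with
  | InExtra => Empty
  | NewFirst =>
      if red 1 \in R then if red r \in R then LeftArrow else Empty
      else if r == 1 then LeftArrow
      else if r == block_max R then DownArrow
      else if red r \in R then LeftArrow else Empty
  | Merged =>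
      if size R == 1 then if red r \in R then DownArrow else Empty
      else if red 1 \in R then if (red r \in R) && (r != 1) then LeftArrow else Empty
      else if r == block_max R then DownArrow
      else if red r \in R then LeftArrow else Empty
  end.

Lemma last_columnE k kd R l0 l r :
  step_view k kd R l0 l -> last_column k.+1 l r = column kd R r.
Proof.
case=> _ c1 c2 rp; rewrite /last_column c1 c2.
by case: kd rp {c1 c2} => // ->.
Qed.

(** Case (3a) is case (3c) for a singleton, whose maximum receives the down arrow. Only R = {1} has
    to be kept out of case (3b), which is the role of the condition on [block_max]. *)
Lemma column_mergedE n R r :
  red_block n R ->
  column Merged R r =
    if (red 1 \in R) && (block_max R != 1)
    then if (red r \in R) && (r != 1) then LeftArrow else Empty
    else if r == block_max R then DownArrow
    else if red r \in R then LeftArrow else Empty.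
Proof.
move=> rR; have [MR Mn leM] := red_block_max rR; rewrite /column.
case: eqP => [sz|sz].
  have ER a : (red a \in R) = (a == block_max R).
    move: sz MR; move: (block_max R) => M; case: (R) => [|y []] //= _; rewrite inE =>
      /eqP<-.
    by rewrite inE /red xpair_eqE.
  by rewrite !ER (eq_sym 1) andbN; case: eqP.
case: ifP => //= R1; case: (block_max R =P 1) => // M1.
case: sz; apply/eqP; rewrite eqn_leq; apply/andP; split; last first.
  by case/andP: rR => /andP[+ _] _; case: (R).
have [/andP[_ /andP[_ dR]] _] := andP rR.
apply: (@leq_trans (size [:: red 1])) => //.
apply: uniq_leq_size (decreasing_uniq dR) _ => x xR.
have [s Es sn] := red_blockP rR xR; rewrite Es inE in xR *.
by have := leM s xR; rewrite M1 => ?; apply/eqP; congr red; lia.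
Qed.

Definition valid_column (n : nat) (c : nat -> cell) : Prop :=
  forall r r', 0 < r -> r < r' <= n -> c r = DownArrow -> c r' = Empty.

(** A down arrow sits only in row max R; the rows below it are outside [R], and the additional left
    arrow of case (2) is in row 1, above it. *)
Lemma column_valid n kd R :
  kind_block n kd R -> valid_column n (column kd R).
Proof.
case: kd => [//|rR|rR] r r' r0 rr'; have [MR Mn leM] := red_block_max rR.
  rewrite /column; case: ifP => R1; first by case: ifP.
  case: eqP => // r1; case: eqP => [EM _|_]; last by case: ifP.
  have -> : (r' == 1) = false by lia.
  have -> : (r' == block_max R) = false by lia.
  by case: ifP => // /leM; lia.
rewrite !(column_mergedE _ rR); case: ifP => _; first by case: ifP.
case: eqP => [EM _|_]; last by case: ifP.
have -> : (r' == block_max R) = false by lia.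
by case: ifP => // /leM; lia.
Qed.

Definition has_down (n : nat) (c : nat -> cell) : bool :=
  has (fun r => c r == DownArrow) (iota 1 n).

(* Reads the deleted block [R] off a column [c].  Row 1 is the only ambiguity: in
   case (2) it always has a left arrow, in case (3) without down arrow it is
   empty although 1^r belongs to [R]. *)
Definition in_block (n : nat) (kd : move_kind) (c : nat -> cell) (r : nat) : bool :=
  match kd with
  | InExtra => false
  | NewFirst => (c r != Empty) && (has_down n c ==> (r != 1))
  | Merged => (c r != Empty) || ~~ has_down n c && (r == 1)
  end.

(** In case (3) row max R is never empty and row 1 never has a left arrow, so these two tests
    separate the three cases. *)
Definition column_kind (n : nat) (c : nat -> cell) : move_kind :=
  if all (fun r => c r == Empty) (iota 1 n) then InExtra
  else if c 1 == LeftArrow then NewFirst else Merged.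

Lemma has_downP n c : reflect (exists2 r, 0 < r <= n & c r = DownArrow) (has_down n c).
Proof.
by apply: (iffP hasP) => -[r rn /eqP cr]; exists r => //; move: rn;
  rewrite mem_iota; lia.
Qed.

Lemma has_down_column n kd R :
  kind_block n kd R ->
  has_down n (column kd R) =
    match kd with InExtra => false | NewFirst => red 1 \notin R
    | Merged => ~~ ((red 1 \in R) && (block_max R != 1)) end.
Proof.
case: kd => [_|rR|rR].
- by apply/hasPn.
- have [MR Mn leM] := red_block_max rR.
  apply/has_downP/idP => [[r rn]|R1]; rewrite /column.
    by case: ifP => //; case: ifP.
  exists (block_max R) => //; rewrite (negPf R1) eqxx.
  by case: eqP MR R1 => // -> ->.
- have [MR Mn leM] := red_block_max rR.
  apply/has_downP/idP => [[r rn]|R1].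
    by rewrite (column_mergedE _ rR); case: ifP => //; case: ifP.
  by exists (block_max R) => //; rewrite (column_mergedE _ rR) (negPf R1) eqxx.
Qed.

Lemma in_block_column n kd R r :
  kind_block n kd R -> 0 < r <= n ->
  in_block n kd (column kd R) r = (red r \in R).
Proof.
move=> ok rn; rewrite /in_block has_down_column //.
case: kd ok => [->//|rR|rR]; have [MR Mn leM] := red_block_max rR.
  rewrite /column; case: (boolP (red 1 \in R)) => R1 /=.
    by rewrite andbT; case: ifP.
  case: (r =P 1) => [->|r1]; first by rewrite (negPf R1) andbF.
  by rewrite andbT; case: (r =P block_max R) => [->|_]; [rewrite MR|case: ifP].
rewrite (column_mergedE _ rR) negbK; case: ifP => [/andP[R1 _]|_] /=.
  by case: (r =P 1) => [->|_]; rewrite ?andbF ?R1 ?andbT ?orbF //; case: ifP.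
by rewrite orbF; case: (r =P block_max R) => [->|_]; [rewrite MR|case: ifP].
Qed.

Lemma column_first n kd R :
  kind_block n kd R ->
  (column kd R 1 == LeftArrow) = (if kd is NewFirst then true else false).
Proof.
case: kd => [_|rR|rR] //; first by rewrite /column !eqxx; case: (red 1 \in R).
rewrite (column_mergedE _ rR) andbF; case: ifP => // /negbT.
by rewrite negb_and negbK eq_sym; case: eqP => //= _; rewrite orbF => /negPf->.
Qed.

Lemma column_kind_column n kd R :
  kind_block n kd R ->
  column_kind n (column kd R) = kd.
Proof.
move=> ok; rewrite /column_kind (column_first ok); case: kd ok => [_|rR|rR].
- by have -> : all (fun r => column InExtra R r == Empty) (iota 1 n) by apply/allP.
- have [MR Mn leM] := red_block_max rR.
  have := column_first (kd := NewFirst) rR; case: allP => // /(_ 1).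
  by rewrite mem_iota => H /eqP c1; rewrite c1 in H; suff: LeftArrow == Empty by [];
    apply: H; lia.
- have [MR Mn leM] := red_block_max rR.
  case: allP => // /(_ (block_max R)); rewrite mem_iota => H.
  suff: column Merged R (block_max R) != Empty by rewrite H //; lia.
  by rewrite (column_mergedE _ rR) eqxx MR; case: ifP => // /andP[_ ->].
Qed.

Lemma eq_column_kind n c c' :
  {in iota 1 n, c =1 c'} -> column_kind n c = column_kind n c'.
Proof.
move=> cc'; rewrite /column_kind.
rewrite (@eq_in_all _ _ (fun r => c' r == Empty)); last by move=> r rn; rewrite cc'.
(* For n = 0 all rows count as empty, so row 1 is read only when it exists. *)
case: allP => // H; case: n cc' H => [|n] cc' H; last by rewrite cc'.
by case: H.
Qed.

Lemma eq_in_block n kd c c' r :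
  {in iota 1 n, c =1 c'} -> 0 < r <= n -> in_block n kd c r = in_block n kd c' r.
Proof.
move=> cc' rn; have rn' : r \in iota 1 n by rewrite mem_iota; lia.
rewrite /in_block /has_down cc' //.
by rewrite (@eq_in_has _ _ (fun r => c' r == DownArrow)) // => s sn; rewrite cc'.
Qed.

Lemma column_inj n kd1 kd2 R1 R2 :
  kind_block n kd1 R1 ->
  kind_block n kd2 R2 ->
  {in iota 1 n, column kd1 R1 =1 column kd2 R2} ->
  kd1 = kd2 /\ R1 = R2.
Proof.
move=> ok1 ok2 cc; have kk : kd1 = kd2.
  by rewrite -(column_kind_column ok1) -(column_kind_column ok2); apply: eq_column_kind.
split=> //; rewrite -{kd2}kk in ok2 cc.
have RR r : 0 < r <= n -> (red r \in R1) = (red r \in R2).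
  by move=> rn; rewrite -(in_block_column ok1 rn) -(in_block_column ok2 rn);
    apply: eq_in_block.
rewrite /kind_block in ok1 ok2; case: kd1 ok1 ok2 {cc} => [-> -> //|rR1|rR1];
  move: rR1 => r1 r2.
all: have [/andP[_ /andP[_ d1]] _] := andP r1; have [/andP[_ /andP[_ d2]] _] := andP r2.
all: apply: decreasing_eq d1 d2 _ => x; apply/idP/idP => xR.
all: first [have [r Er rn] := red_blockP r1 xR; by rewrite Er -RR // -Er
           |have [r Er rn] := red_blockP r2 xR; by rewrite Er RR // -Er].
Qed.

(** The block is read off by [in_block]. Validity of [c] empties the rows below a down arrow, which
    puts that arrow at the maximum of the block, as [column] requires. *)
Lemma column_surj n c :
  valid_column n c ->
  exists kd R, kind_block n kd R /\
    {in iota 1 n, column kd R =1 c}.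
Proof.
move=> vc; have [aE|nE] := boolP (all (fun r => c r == Empty) (iota 1 n)).
  by exists InExtra, [::]; split=> // r /(allP aE) /eqP->.
have [s sn cs] : exists2 s, 0 < s <= n & c s != Empty.
  by case/allPn: nE => s; rewrite mem_iota => ? ?; exists s => //; lia.
have n0 : 0 < n by lia.
pose kd := if c 1 == LeftArrow then NewFirst else Merged.
pose R := block_of n (in_block n kd c).
exists kd, R.
have mR r : 0 < r <= n -> (red r \in R) = in_block n kd c r.
  by move=> rn; rewrite mem_block_of rn.
have rR : red_block n R.
  apply: block_of_ok; apply/hasP.
  rewrite /in_block /kd; case: eqP => c1; last first.
    by exists s; rewrite ?cs // mem_iota; lia.
  have [/has_downP[d dn cd]|_] := boolP (has_down n c).
    exists d; first by rewrite mem_iota; lia.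
    by rewrite cd /=; apply/eqP => d1; rewrite d1 c1 in cd.
  by exists s; rewrite ?cs // mem_iota; lia.
split; first by rewrite /kind_block /kd; case: ifP.
have [MR Mn leM] := red_block_max rR.
have maxD d : 0 < d <= n -> c d = DownArrow -> block_max R = d.
  move=> dn cd; apply/eqP; rewrite eqn_leq; apply/andP; split.
    rewrite leqNgt; apply/negP => dM.
    have cM : c (block_max R) = Empty by apply: (vc d) => //; lia.
    move: MR; rewrite mR // /in_block cM /=.
    have -> : has_down n c by apply/has_downP; exists d.
    by case: (kd).
  suff /leM : red d \in R by lia.
  rewrite mR // /in_block cd /= /kd; case: eqP => // c1.
  by apply/implyP => _; apply/eqP => d1; rewrite d1 c1 in cd.
move=> r; rewrite mem_iota => rn'; have rn : 0 < r <= n by lia.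
have mr := mR r rn; have m1 := mR 1 (n0 : 0 < 1 <= n).
move: mr m1 maxD; rewrite /kd; case: eqP => c1; rewrite /in_block.
  have [/has_downP[d dn cd]|hD] := boolP (has_down n c) => mr m1 maxD.
    have Md := maxD d dn cd; rewrite /column m1 c1 /=.
    case: eqP => [->//|r1]; case: eqP => [->|rM]; first by rewrite Md.
    rewrite mr; case cr: (c r) => //=; last by case: rM; rewrite (maxD r rn cr).
    by case: eqP r1.
  rewrite /column m1 c1 /= mr andbT.
  case cr: (c r) => //=; case/has_downP: hD; by exists r.
have [/has_downP[d dn cd]|hD] := boolP (has_down n c) => mr m1 maxD.
  have Md := maxD d dn cd; rewrite (column_mergedE _ rR) Md m1 mr /= !orbF.
  have -> : (c 1 != Empty) && (d != 1) = false.
    case: (eqVneq d 1) => [_|d1]; rewrite ?andbF // andbT.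
    by case c1': (c 1) => //; rewrite -Md (maxD 1 n0 c1') in d1.
  case: eqP => [->//|rd]; case cr: (c r) => //=.
  by case: rd; rewrite -Md (maxD r rn cr).
have nD r' : 0 < r' <= n -> c r' != DownArrow.
  by move=> rn0; apply: contra hD => /eqP cr; apply/has_downP; exists r'.
have E1 : c 1 = Empty by case c1': (c 1) (nD 1 n0) c1 => // _ [].
rewrite (column_mergedE _ rR) m1 mr eqxx orbT /=.
(* Otherwise the nonempty row [s] would be row 1, which is empty here. *)
have -> /= : block_max R != 1.
  apply/eqP => M1; have : red s \in R by rewrite mR // /in_block /kd; case: eqP c1 =>
    //; rewrite cs.
  move/leM; rewrite M1 => s1; suff E : s = 1 by rewrite E E1 in cs.
  lia.
case: (eqVneq r 1) => [->|_]; first by rewrite andbF E1.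
by rewrite orbF andbT; case cr: (c r) (nD r rn).
Qed.

(** * The red symbols left after deleting a block *)

Lemma count_add (a b c d : pred nat) s :
  {in s, forall x, a x + b x = c x + d x} -> count a s + count b s = count c s +
    count d s.
Proof.
elim: s => //= x s IH H; have := H x (mem_head _ _).
have {}IH := IH (fun y ys => H y (@mem_behead _ (x :: s) y ys)); lia.
Qed.

Definition reduced_reds (n : nat) (kd : move_kind) (R : block) : seq nat :=
  match kd with
  | InExtra => iota 1 n
  | NewFirst => [seq r <- iota 1 n | red r \notin R]
  | Merged => 0 :: [seq r <- iota 1 n | red r \notin R]
  end.

(** The left arrows occupy the rows of [R] up to one or two corrections: in case (2) with 1 outside
    [R], row 1 replaces row max R; in case (3) one row of [R] lacks its left arrow, which the marker
    0 makes up for. *)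
Lemma count_column n kd R :
  kind_block n kd R ->
  count (fun r => column kd R r != LeftArrow) (iota 1 n) = size (reduced_reds n kd R).
Proof.
case: kd => [_|rR|rR]; rewrite /reduced_reds [size _]/= ?size_filter.
- by rewrite -[RHS]count_predT; apply: eq_count.
- have [MR Mn leM] := red_block_max rR.
  rewrite /column; have [R1|R1] := boolP (red 1 \in R).
    by apply: eq_count => r; case: ifP.
  apply/eqP; rewrite -(eqn_add2r 1); apply/eqP.
  rewrite -[X in _ + X = _](_ : count_mem 1 (iota 1 n) = 1); last first.
    by rewrite count_uniq_mem ?iota_uniq // mem_iota; lia.
  rewrite -[X in _ = _ + X](_ : count_mem (block_max R) (iota 1 n) = 1); last first.
    by rewrite count_uniq_mem ?iota_uniq // mem_iota; lia.
  apply: count_add => r _ /=.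
  have [->|r1] := eqVneq r 1.
    by rewrite R1 eqxx; case: (1 =P block_max R) => // M1; rewrite M1 MR in R1.
  have [->|_] := eqVneq r (block_max R); first by rewrite MR.
  by case: ifP.
- have [MR Mn leM] := red_block_max rR; rewrite -[RHS]addn1.
  rewrite -[LHS]addn0 -[X in _ + X = _](count_pred0 (iota 1 n)).
  have [R1|R1] := boolP ((red 1 \in R) && (block_max R != 1)).
    rewrite -[X in _ = _ + X](_ : count_mem 1 (iota 1 n) = 1); last first.
      by rewrite count_uniq_mem ?iota_uniq // mem_iota; lia.
    apply: count_add => r _; rewrite (column_mergedE _ rR) R1 /=.
    have [->|r1] := eqVneq r 1; last by rewrite andbT; case: ifP.
    by case/andP: R1 => -> _.
  rewrite -[X in _ = _ + X](_ : count_mem (block_max R) (iota 1 n) = 1); last first.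
    by rewrite count_uniq_mem ?iota_uniq // mem_iota; lia.
  apply: count_add => r _; rewrite (column_mergedE _ rR) (negPf R1) /=.
  by have [->|_] := eqVneq r (block_max R); [rewrite MR|case: ifP].
Qed.

Lemma red_block_split n R :
  red_block n R ->
  perm_eq (map red (iota 1 n)) (R ++ map red [seq r <- iota 1 n | red r \notin R]).
Proof.
move=> rR; have [/andP[_ /andP[_ dR]] _] := andP rR.
have pR : perm_eq R (map red [seq r <- iota 1 n | red r \in R]).
  apply: uniq_perm; first exact: decreasing_uniq.
    by rewrite map_inj_uniq ?filter_uniq ?iota_uniq // => ? ? [].
  move=> x; apply/idP/mapP => [xR|[r]]; last by rewrite mem_filter => /andP[? _] ->.
  have [r Er rn] := red_blockP rR xR; exists r => //.
  by rewrite mem_filter -Er xR mem_iota; lia.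
rewrite perm_sym (perm_trans (perm_cat pR (perm_refl _))) // -map_cat.
by apply: perm_map; rewrite (perm_filterC (fun r => red r \in R)).
Qed.

Lemma reduced_reds_split n kd R :
  kind_block n kd R -> reds_split kd (iota 1 n) R (reduced_reds n kd R).
Proof.
rewrite /reds_split /kind_block; case: kd => [->|rR|rR] //=;
  first exact: red_block_split.
rewrite perm_sym perm_catC /= perm_cons perm_catC perm_sym.
exact: red_block_split.
Qed.

Lemma reduced_reds_sorted n kd R : sorted ltn (reduced_reds n kd R).
Proof.
have sf : sorted ltn [seq r <- iota 1 n | red r \notin R].
  by apply: sorted_filter (iota_ltn_sorted 1 n); apply: ltn_trans.
case: kd => //=; first exact: iota_ltn_sorted.
rewrite path_sortedE ?sf ?andbT; last exact: ltn_trans.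
by apply/allP => r; rewrite mem_filter mem_iota; lia.
Qed.

(** * One step of the recursion on permutations *)

Lemma step_sub k kd R l0 l : step k kd R l0 l -> {subset R <= l.1 ++ l.2}.
Proof.
case=> *; move=> z zR; rewrite /assemble ?map_cat ?flatten_cat /= !(mem_cat, inE).
all: by rewrite ?zR ?orbT.
Qed.

Lemma zero_notin_iota n : 0 \notin iota 1 n.
Proof. by rewrite mem_iota. Qed.

Lemma callan_over_step n k l :
  callan_over (iota 1 n) k.+1 l ->
  exists kd R l0, [/\ kind_block n kd R, step k kd R l0 l
    & callan_over (reduced_reds n kd R) k l0].
Proof.
move=> dl; have [kd [R [l0 [st okR]]]] := step_onto (zero_notin_iota n) dl.
have bR_ok : proper_block true R -> red_block n R.
  move=> bR; rewrite /red_block bR; apply/allP => x xR.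
  have /andP[_ /andP[/allP cR _]] := bR.
  have /eqP := cR x xR; have := step_sub st xR.
  by case: x {xR} => [[] v] //= /(callan_over_red dl).
have rR : kind_block n kd R by case: kd okR {st}.
exists kd, R, l0; split=> //.
by rewrite -(step_dcallan st (reduced_reds_split rR)).
Qed.

Lemma callan_over_view n k kd R l0 l :
  callan_over (reduced_reds n kd R) k l0 -> step k kd R l0 l -> step_view k kd R l0 l.
Proof. by move=> d0 st; apply: step_viewP st (blue_notin d0). Qed.

Lemma block_minima_relabel U k l :
  callan_over U k l -> block_minima (relabel_reds l) = block_minima l.
Proof.
move=> dl; rewrite (relabel_redsE dl) /block_minima /=.
rewrite (callan_pairs_map _ (is_red_recolor _)) -map_comp.
have [_ w1 _] := and3P dl; have [_ /allP ps _] := callan_word_blocks w1.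
apply/eq_in_map => p /ps /andP[/andP[_ /andP[/allP cp _]] _] /=.
congr block_min; rewrite -[RHS]map_id; apply/eq_in_map => x /cp.
by rewrite /recolor_red /colored; case: is_red.
Qed.

(** The renumbering in [F_cell]: at a free row it is the new row number, at the last row the number
    of rows of the smaller tableau. *)
Definition left_free (c : nat -> cell) (n : nat) : nat :=
  count (fun i => c i != LeftArrow) (iota 1 n).

(** With [phi_column_inj] and [phi_column_surj], this is the interface of the permutation side: the
    inductions on [k] below do not look at blocks again. *)
Lemma phi_decomposes n k l :
  is_double_callan n k.+1 l ->
  let c := last_column k.+1 l in
  [/\ valid_column n c,
      is_double_callan (left_free c n) k (phi k.+1 l)
    & records k.+2 (block_minima l)
        = records k.+1 (block_minima (phi k.+1 l)) + ((0 < n) && (c 1 == LeftArrow))].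
Proof.
rewrite is_double_callan_over => dl; have [kd [R [l0 [rR st d0]]]] :=
  callan_over_step dl.
have sv := callan_over_view d0 st; have cE r := last_columnE r sv.
rewrite /= phiE; have [-> _ _ _] := sv; split.
- move=> r r' r0 rr'; rewrite !cE; exact: (column_valid rR).
- rewrite is_double_callan_over /left_free (eq_count (a2 := fun i =>
  column kd R i != LeftArrow)).
    by rewrite (count_column rR); apply: relabel_ok (reduced_reds_sorted _ _ _) d0.
  by move=> r /=; rewrite cE.
- rewrite (block_minima_relabel d0) (step_records st d0) cE (column_first rR).
  case: kd {st sv cE d0} rR => [_|rR|_]; rewrite ?andbF ?andbT //.
  by have [_ Mn _] := red_block_max rR; have -> : 0 < n by lia.
Qed.

Lemma phi_column_inj n k l1 l2 :
  is_double_callan n k.+1 l1 -> is_double_callan n k.+1 l2 ->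
  {in iota 1 n, last_column k.+1 l1 =1 last_column k.+1 l2} ->
  phi k.+1 l1 = phi k.+1 l2 -> l1 = l2.
Proof.
rewrite !is_double_callan_over => dl1 dl2.
have [kd [R [m1 [rR1 st1 d1]]]] := callan_over_step dl1.
have [kd2 [R2 [m2 [rR2 st2 d2]]]] := callan_over_step dl2.
have sv1 := callan_over_view d1 st1; have sv2 := callan_over_view d2 st2 => cc.
have [|Ek ER] := column_inj rR1 rR2.
  by move=> r rn; rewrite -(last_columnE r sv1) -(last_columnE r sv2) cc.
rewrite -{kd2}Ek -{R2}ER in rR2 st2 d2 sv2.
rewrite !phiE; have [-> _ _ _] := sv1; have [-> _ _ _] := sv2.
move/(relabel_inj (reduced_reds_sorted n kd R) d1 d2) => Em.
rewrite (step_undo st1 (red0_notin (zero_notin_iota n) dl1)).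
by rewrite (step_undo st2 (red0_notin (zero_notin_iota n) dl2)) Em.
Qed.

Lemma phi_column_surj n k c l' :
  valid_column n c -> is_double_callan (left_free c n) k l' ->
  exists l, [/\ is_double_callan n k.+1 l, {in iota 1 n, last_column k.+1 l =1 c}
              & phi k.+1 l = l'].
Proof.
move=> vc; rewrite is_double_callan_over => d'; have [kd [R [rR cE]]] := column_surj vc.
have EU : left_free c n = size (reduced_reds n kd R).
  by rewrite -(count_column rR); apply: eq_in_count => r rn /=; rewrite cE.
rewrite EU in d'; have [l0 d0 El'] := relabel_surj (reduced_reds_sorted n kd R) d'.
have [l st] : exists l, step k kd R l0 l.
  apply: (step_from d0); first by case: kd rR {cE EU d' d0} => // /andP[].
  by case: kd {cE EU d' d0 rR} => //=; rewrite inE eqxx.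
have sv := callan_over_view d0 st; exists l; split.
- by rewrite is_double_callan_over (step_dcallan st (reduced_reds_split rR)).
- by move=> r rn; rewrite (last_columnE r sv) cE.
- by rewrite phiE; have [-> _ _ _] := sv.
Qed.

(** * The recursion on tableaux *)

Lemma unrank_mem U j : 0 < j <= size U -> unrank U j \in U.
Proof. by case: j => // j; apply: mem_nth. Qed.

Definition free_rows (c : nat -> cell) (n : nat) : seq nat :=
  [seq i <- iota 1 n | c i != LeftArrow].

Lemma free_rows_sorted c n : sorted ltn (free_rows c n).
Proof. by apply: sorted_filter (iota_ltn_sorted 1 n); apply: ltn_trans. Qed.

Lemma size_free_rows c n : size (free_rows c n) = left_free c n.
Proof. by rewrite size_filter. Qed.

Lemma mem_free_rows c n r : (r \in free_rows c n) = (c r != LeftArrow) && (0 < r <= n).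
Proof. by rewrite mem_filter mem_iota; congr (_ && _); lia. Qed.

(** Identifies the renumbering of rows with [rank], so that monotonicity and the inverse [unrank]
    carry over from the relabelling of red symbols. *)
Lemma left_free_rank c n r : r <= n -> left_free c r = rank (free_rows c n) r.
Proof.
move=> rn; rewrite /rank /free_rows count_filter -(subnKC rn) iotaD count_cat.
rewrite [X in _ = _ + X](_ : _ = 0) ?addn0.
  by apply: eq_in_count => i; rewrite mem_iota /=; case: (c i == LeftArrow); lia.
apply/eqP; rewrite -leqn0 leqNgt -has_count; apply/hasPn => i.
by rewrite mem_iota /=; lia.
Qed.

Lemma left_free_range c n r :
  r \in free_rows c n -> 0 < left_free c r <= left_free c n.
Proof.
move=> rf; have := rf; rewrite mem_free_rows => /and3P[_ _ rn].
have : rank (free_rows c n) r \in iota 1 (left_free c n).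
  by rewrite -size_free_rows -(map_rank (free_rows_sorted c n)) map_f.
by rewrite mem_iota -left_free_rank //; lia.
Qed.

Lemma left_free_homo c n r r' :
  r \in free_rows c n -> r' \in free_rows c n -> r < r' -> left_free c r < left_free
    c r'.
Proof.
move=> rf rf'; have := rf; have := rf'.
rewrite !mem_free_rows => /and3P[_ _ rn'] /and3P[_ _ rn] rr'.
by rewrite !(left_free_rank c (n := n)) // rank_homo.
Qed.

Lemma left_free_onto c n j :
  0 < j <= left_free c n -> exists2 r, r \in free_rows c n & left_free c r = j.
Proof.
rewrite -size_free_rows => jn; exists (unrank (free_rows c n) j).
  exact: unrank_mem.
have := unrank_mem jn.
rewrite mem_free_rows => /and3P[_ _ rn]; rewrite (left_free_rank c rn).
by rewrite unrankK ?free_rows_sorted // mem_iota; lia.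
Qed.

(** Tableaux as functions of 1-based numbers: the number of rows changes along the recursion, and no
    casts between matrix types are needed. *)
Definition tableau_on (n k : nat) (T : nat -> nat -> cell) : Prop :=
  (forall r c c', 0 < r <= n -> 0 < c' -> c' < c <= k ->
     T r c = LeftArrow -> T r c' = Empty)
  /\ (forall c, 0 < c <= k -> valid_column n (T^~ c)).

Lemma F_cellS k l r c :
  F_cell k.+1 l r c =
    if c == k.+1 then last_column k.+1 l r
    else if last_column k.+1 l r == LeftArrow then Empty
    else F_cell k (phi k.+1 l) (left_free (last_column k.+1 l) r) c.
Proof. by []. Qed.

Lemma F_cell_tableau n k l : is_double_callan n k l -> tableau_on n k (F_cell k l).
Proof.
elim: k n l => [|k IH] n l dl; first by split=> [r c c' _ _ ?|c ?]; exfalso; lia.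
have [vc dp _] := phi_decomposes dl; have [row col] := IH _ _ dp.
split=> [r c c' rn c'0 c'c|c cn r r' r0 rr'].
  rewrite !F_cellS; have -> : (c' == k.+1) = false by lia.
  case: (c =P k.+1) => [_|ck]; first by move->; rewrite eqxx.
  case: eqP => // /eqP nL; apply: row; try lia.
  by apply: left_free_range; rewrite mem_free_rows nL.
rewrite !F_cellS; case: (c =P k.+1) => [_|ck]; first exact: vc.
case: eqP => // /eqP nL; case: eqP => // /eqP nL'.
have rf : r \in free_rows (last_column k.+1 l) n by rewrite mem_free_rows nL; lia.
have rf' : r' \in free_rows (last_column k.+1 l) n by rewrite mem_free_rows nL'; lia.
have := left_free_range rf; have := left_free_range rf'.
have := left_free_homo rf rf' _ => H.
by move=> ? ?; apply: col; try lia; have := H (proj1 (andP rr')); lia.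
Qed.

(** The first word would have to start blue, so it is empty, and the second is a single decreasing
    red run. *)
Lemma callan_no_blue n l :
  is_double_callan n 0 l -> l = ([::], map red (rev (iota 1 n))).
Proof.
rewrite is_double_callan_over => dl; have [+ w1 w2] := and3P dl.
rewrite cats0 => pl; case: l dl pl w1 w2 => s1 s2 /= dl pl w1 w2.
have reds x : x \in s1 ++ s2 -> is_red x.
  by rewrite (perm_mem pl) => /mapP[r _ ->].
have s10 : s1 = [::].
  case: s1 {dl pl} w1 reds => // x s1 /andP[/= xc _] /(_ x).
  by rewrite mem_head (eqP xc) => /(_ isT).
rewrite {s1}s10 /= in pl w1 reds dl *; congr (_, _).
apply: decreasing_eq.
- have [->//|s20] := eqVneq s2 [::]; have /andP[_] := w2.
  rewrite (@runs1 true) //; first by rewrite /= andbT.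
  by apply/allP => x /reds; rewrite /colored => ->.
- by rewrite /decreasing sorted_map /relpre /= rev_sorted; apply: iota_ltn_sorted.
- by move=> x; rewrite (perm_mem pl) !map_rev mem_rev.
Qed.

Lemma F_cell_inj n k l1 l2 :
  is_double_callan n k l1 -> is_double_callan n k l2 ->
  (forall r c, 0 < r <= n -> 0 < c <= k -> F_cell k l1 r c = F_cell k l2 r c) ->
  l1 = l2.
Proof.
elim: k n l1 l2 => [|k IH] n l1 l2 d1 d2 EF.
  by rewrite (callan_no_blue d1) (callan_no_blue d2).
have cc : {in iota 1 n, last_column k.+1 l1 =1 last_column k.+1 l2}.
  move=> r; rewrite mem_iota => rn; have := EF r k.+1.
  by rewrite !F_cellS eqxx; apply; lia.
have [_ p1 _] := phi_decomposes d1; have [_ p2 _] := phi_decomposes d2.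
have ccr r : r <= n -> left_free (last_column k.+1 l1) r = left_free (last_column
  k.+1 l2) r.
  move=> rn; apply: eq_in_count => i; rewrite mem_iota => ir.
  by rewrite cc // mem_iota; lia.
apply: (phi_column_inj d1 d2 cc); rewrite -ccr // in p2; apply: (IH _ _ _ p1 p2).
move=> j c jn ck; have [r rf <-] := left_free_onto jn.
have := rf; rewrite mem_free_rows => /andP[nL rn].
have := EF r c rn; rewrite !F_cellS.
have -> : (c == k.+1) = false by lia.
rewrite -cc ?mem_iota; last lia.
rewrite (negPf nL) -ccr; last lia.
by apply; lia.
Qed.

Lemma F_cell_surj n k T :
  tableau_on n k T ->
  exists2 l, is_double_callan n k l &
    forall r c, 0 < r <= n -> 0 < c <= k -> F_cell k l r c = T r c.
Proof.
elim: k n T => [|k IH] n T [row col].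
  exists ([::], map red (rev (iota 1 n))); last by move=> r c _ ?; exfalso; lia.
  rewrite is_double_callan_over; apply/and3P; split=> //=.
    by rewrite cats0 map_rev perm_rev.
  have := @callan_word_assemble true [::] (map red (rev (iota 1 n))) isT.
  apply; rewrite /colored_block /decreasing sorted_map /relpre /= rev_sorted
    iota_ltn_sorted andbT.
  by apply/allP => x /mapP[r _ ->].
pose c0 r := T r k.+1; pose V := free_rows c0 n.
have VP j : 0 < j <= left_free c0 n -> unrank V j \in V.
  by rewrite -size_free_rows; apply: unrank_mem.
(* The smaller tableau is [T] restricted to the rows without left arrow in the last column,
   renumbered through [unrank V]. *)
have [|l' d' El'] := IH (left_free c0 n) (fun j => T (unrank V j)).
  split=> [r c c' rn c'0 c'k|c cn r r' r0 rr'].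
    by apply: row => //; [have := VP r rn; rewrite mem_free_rows => /andP[]|lia].
  have vr : 0 < r <= left_free c0 n by lia.
  have vr' : 0 < r' <= left_free c0 n by lia.
  have := VP r vr; have := VP r' vr'; rewrite !mem_free_rows =>
    /and3P[_ _ ?] /and3P[_ ? _].
  apply: col => //; first lia.
  apply/andP; split=> //; apply: (unrank_homo (free_rows_sorted c0 n)); last lia.
    by rewrite size_free_rows mem_iota; lia.
  by rewrite size_free_rows mem_iota; lia.
have [|l [dl cE pE]] := @phi_column_surj n k c0 l' _ d'; first by apply: col; lia.
exists l => // r c rn ck.
have cEr i : 0 < i <= n -> last_column k.+1 l i = c0 i.
  by move=> iN; apply: cE; rewrite mem_iota; lia.
rewrite F_cellS cEr //; case: (c =P k.+1) => [->//|ck'].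
(* The emptiness that [F_cell] imposes left of an arrow in the last column holds in [T] by the row
   condition. *)
case: eqP => [cL|/eqP nL]; first by rewrite (row r k.+1 c) //; lia.
have rV : r \in V by rewrite mem_free_rows nL.
have -> : left_free (last_column k.+1 l) r = left_free c0 r.
  by apply: eq_in_count => i; rewrite mem_iota => ir; rewrite cEr //; lia.
rewrite pE El'; [|exact: left_free_range|lia].
rewrite (left_free_rank c0 (n := n)); last lia.
by rewrite rankK // free_rows_sorted.
Qed.

(** * Weights *)

Fixpoint left_col (T : nat -> nat -> cell) (k r : nat) : nat :=
  if k is k'.+1 then if T r k == LeftArrow then k else left_col T k' r else 0.

Lemma left_col_le T k r : left_col T k r <= k.
Proof. by elim: k => //= k IH; case: ifP => // _; apply: leqW. Qed.

Lemma left_col_left T k r : 0 < left_col T k r -> T r (left_col T k r) = LeftArrow.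
Proof. by elim: k => //= k IH; case: eqP. Qed.

Lemma left_col_ge T k r c : 0 < c <= k -> T r c = LeftArrow -> c <= left_col T k r.
Proof.
elim: k => [|k IH] /=; first lia.
move=> ck Tc; case: eqP => [|Tk]; first lia.
by apply: IH => //; case: (c =P k.+1) => [E|]; [rewrite E in Tc|lia].
Qed.

Lemma left_col_uniq n k T r c :
  tableau_on n k T -> 0 < r <= n -> 0 < c <= k -> T r c = LeftArrow ->
  left_col T k r = c.
Proof.
move=> [row _] rn ck Tc; have cl := left_col_ge ck Tc.
have lk := left_col_le T k r.
have Tl : T r (left_col T k r) = LeftArrow by apply: left_col_left; lia.
case: (ltngtP c (left_col T k r)) => // [lt|]; last lia.
by rewrite (row r (left_col T k r) c) // in Tc; lia.
Qed.

Lemma left_col_F k l r :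
  left_col (F_cell k.+1 l) k.+1 r =
    if last_column k.+1 l r == LeftArrow then k.+1
    else left_col (F_cell k (phi k.+1 l)) k (left_free (last_column k.+1 l) r).
Proof.
rewrite [LHS]/= eqxx; case: ifP => // nL.
suff H k' : k' <= k -> left_col (F_cell k.+1 l) k' r
   = left_col (F_cell k (phi k.+1 l)) k' (left_free (last_column k.+1 l) r) by apply: H.
elim: k' => // k' IH k'k; rewrite /left_col -/left_col IH 1?ltnW // F_cellS nL.
by have -> : (k'.+1 == k.+1) = false by lia.
Qed.

Lemma records_filter m x s :
  0 < x -> m <= x -> records m [seq y <- s | y != x] = records m s.
Proof.
move=> x0; elim: s m => //= y s IH m mx; case: (y =P x) => [->|yx] /=.
  by rewrite IH // eqn0Ngt x0 ltnNge mx.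
by case: eqP => // _; case: ltnP => ym; rewrite IH // ltnW // (leq_trans ym).
Qed.

(* A maximal entry is a record only in first position. *)
Lemma records_max k s :
  all (fun x => x <= k.+1) s ->
  records k.+2 s = records k.+1 [seq y <- s | y != k.+1] + (head 0 s == k.+1).
Proof.
case: s => //= x s /andP[xk _]; case: (x =P k.+1) => [->|xk'] /=.
  by rewrite ltnSn records_filter // addn1.
rewrite addn0; case: eqP => // _.
have -> : x < k.+2 by lia.
have -> : x < k.+1 by lia.
by rewrite records_filter //; lia.
Qed.

(** All values of [f] are below [m], so removing [m] drops exactly the rows with a left arrow in
    [c], and the others are numbered consecutively. *)
Lemma filter_columns (c : nat -> cell) (f : nat -> nat) m n :
  (forall j, f j < m) ->
  [seq y <- [seq (if c r == LeftArrow then m else f (left_free c r)) | r <- iota 1 n]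
     | y != m] = map f (iota 1 (left_free c n)).
Proof.
move=> fm; elim: n => // n IH.
have iS j : iota 1 j.+1 = rcons (iota 1 j) j.+1.
  by rewrite -(addn1 j) iotaD cats1 add1n addn1.
have lS : left_free c n.+1 = left_free c n + (c n.+1 != LeftArrow).
  by rewrite /left_free iS -cats1 count_cat /= addn0.
rewrite iS map_rcons filter_rcons IH lS.
case: (c n.+1 == LeftArrow) => /=; first by rewrite eqxx addn0.
by rewrite addn1 iS map_rcons neq_ltn fm.
Qed.

(** Both sides obey the same recursion. Rows with a left arrow in the last column do not interrupt
    the initial run, so dropping them changes the count only when row 1 is among them. *)
Lemma records_left_col n k l :
  is_double_callan n k l ->
  records k.+1 [seq left_col (F_cell k l) k r | r <- iota 1 n]
    = records k.+1 (block_minima l).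
Proof.
elim: k n l => [|k IH] n l dl.
  have := dl; rewrite is_double_callan_over => /minima_bound.
  case: (block_minima l) => [_|m s /andP[]]; last lia.
  by case: n {dl}.
have [_ dp ->] := phi_decomposes dl.
rewrite (eq_map (left_col_F k l)) records_max; last first.
  apply/allP => _ /mapP[r _ ->]; case: ifP => // _.
  by rewrite leqW ?left_col_le.
rewrite (@filter_columns _ (left_col (F_cell k (phi k.+1 l)) k)); last first.
  by move=> j; rewrite ltnS left_col_le.
rewrite IH //; congr (_ + _); case: n {dl dp} => //= n; congr nat_of_bool.
case: ifP => [_|_]; first exact: eqxx.
by apply/negbTE; rewrite neq_ltn ltnS left_col_le.
Qed.

(** [records] position by position, the form in which both weights are given as cardinalities. *)
Definition record_at (m : nat) (s : seq nat) (i : nat) : bool :=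
  [&& all (fun x => x != 0) (take i.+1 s), nth 0 s i < m
    & all (fun x => nth 0 s i < x) (take i s)].

Lemma sum_record_at m s : \sum_(i < size s) record_at m s i = records m s.
Proof.
elim: s m => [|x s IH] m; first by rewrite big_ord0.
rewrite big_ord_recl /record_at /= take0 /= !andbT.
case: eqP => [x0|_] /=.
  by rewrite big1.
have [xm|mx] := ltnP x m; rewrite -IH ?add1n ?add0n.
  congr _.+1; apply: eq_bigr => i _; rewrite /record_at /bump /= add1n add0n.
  congr nat_of_bool; congr (_ && _); case: (ltnP (nth 0 s i) x) => nx /=;
    last by rewrite andbF.
  by rewrite (ltn_trans nx xm).
apply: eq_bigr => i _; rewrite /record_at /bump /= add1n add0n.
congr nat_of_bool; congr (_ && _); case: (ltnP (nth 0 s i) m) => nm //=.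
by rewrite (leq_trans nm mx).
Qed.

Lemma all_takeP (a : pred nat) s i :
  i <= size s ->
  reflect (forall j, j < i -> a (nth 0 s j)) (all a (take i s)).
Proof.
move=> si; apply: (iffP (all_nthP 0)); rewrite size_takel // => H j ji.
  by have := H j ji; rewrite nth_take.
by rewrite nth_take //; apply: H.
Qed.

Lemma card_record_at (N m : nat) s (A : {set 'I_N}) :
  N = size s -> (forall i, (i \in A) = record_at m s i) -> #|A| = records m s.
Proof.
move=> Ns AE; rewrite -sum_record_at -Ns -sum1_card big_mkcond /=.
by apply: eq_bigr => i _; rewrite AE; case: record_at.
Qed.

Lemma w_lrE n k l : is_double_callan n k l -> w_lr l = records k.+1 (block_minima l).
Proof.
rewrite is_double_callan_over => /minima_bound /allP mb; rewrite /w_lr.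
have sz : size (callan_pairs l.1) = size (block_minima l) by rewrite size_map.
have nE j : j < size (callan_pairs l.1) ->
    block_min (nth ([::], [::]) (callan_pairs l.1) j).1 = nth 0 (block_minima l) j.
  by move=> jl; rewrite /block_minima (nth_map ([::], [::])).
have nb j : j < size (callan_pairs l.1) -> 0 < nth 0 (block_minima l) j <= k.
  by move=> jl; apply/mb/mem_nth; rewrite -sz.
apply: card_record_at => // i; rewrite inE /record_at.
have -> /= : all (fun x => x != 0) (take i.+1 (block_minima l)).
  by apply/allP => x /mem_take /mb /andP[]; rewrite lt0n.
have /andP[_ ->] /= : 0 < nth 0 (block_minima l) i < k.+1 by apply: nb.
apply/forallP/all_takeP => [|H j|H j]; first by rewrite -sz ltnW.
- move=> ji; have jl : j < size (callan_pairs l.1) by apply: ltn_trans ji _.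
  by have /implyP := H (Ordinal jl); rewrite /= !nE //; apply.
- by apply/implyP => ji; rewrite !nE //; apply: H.
Qed.

Lemma w_stE n k (T : nat -> nat -> cell) :
  tableau_on n k T ->
  w_st (\matrix_(i < n, j < k) T i.+1 j.+1)
    = records k.+1 [seq left_col T k r | r <- iota 1 n].
Proof.
move=> tT; set t := (X in w_st X); set s := map _ _.
have sz : n = size s by rewrite size_map size_iota.
have nE i : i < n -> nth 0 s i = left_col T k i.+1.
  by move=> iN; rewrite (nth_map 0) ?size_iota // nth_iota.
have tE i j : t i j = T i.+1 j.+1 by rewrite mxE.
have leftP (i : 'I_n) (j : 'I_k) : (t i j == LeftArrow) = (nth 0 s i == j.+1).
  rewrite tE nE //; apply/eqP/eqP => [H|H]; first by apply: left_col_uniq tT _ _ H;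
    rewrite /= ltn_ord.
  by rewrite -H; apply: left_col_left; rewrite H.
have rowP (i : 'I_n) : row_has_left t i = (nth 0 s i != 0).
  apply/existsP/idP => [[j]|]; first by rewrite leftP => /eqP->.
  have := left_col_le T k i.+1; rewrite -nE //; case E: (nth 0 s i) => [|c] // ck _.
  by exists (Ordinal ck); rewrite leftP E.
apply: card_record_at => // i; rewrite inE /record_at.
have -> : in_initial_run t i = all (fun x => x != 0) (take i.+1 s).
  apply/forallP/all_takeP => [|H j|H j]; first by rewrite -sz.
    rewrite ltnS => ji; have jn : j < n by apply: leq_ltn_trans ji _.
    by have /implyP := H (Ordinal jn); rewrite rowP; apply.
  by apply/implyP => ji; rewrite rowP; apply: H.
have si : i < size s by rewrite -sz.
(* Outside the initial run both sides are false; inside it every row above has a column number to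
   compare with. *)
case: (all_takeP _ si) => [nz|//].
have -> /= : nth 0 s i < k.+1 by rewrite nE // ltnS left_col_le.
apply/existsP/all_takeP => [|[j /andP[]]|H]; first by rewrite -sz ltnW.
  rewrite leftP => /eqP Ej /forallP H i' i'i; rewrite Ej.
  have i'n : i' < n by apply: ltn_trans i'i _.
  have := nz i' (leqW i'i); case E: (nth 0 s i') => [|c] // _.
  have ck : c < k by rewrite -E nE // left_col_le.
  have /implyP/(_ i'i)/forallP/(_ (Ordinal ck)) := H (Ordinal i'n).
  by rewrite leftP /= E eqxx.
have := nz i (ltnSn i); case E: (nth 0 s i) => [|c] // _.
have ck : c < k by rewrite -E nE // left_col_le.
exists (Ordinal ck); rewrite leftP E eqxx /=; apply/forallP => i'; apply/implyP => i'i.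
apply/forallP => j'; rewrite leftP; apply/implyP => /eqP Ej'.
by have := H i' i'i; rewrite E Ej'.
Qed.

Lemma is_tableauP n k (T : nat -> nat -> cell) :
  reflect (tableau_on n k T) (is_tableau (\matrix_(i < n, j < k) T i.+1 j.+1)).
Proof.
set t := (X in is_tableau X); have tE i j : t i j = T i.+1 j.+1 by rewrite mxE.
apply: (iffP andP) => -[row col]; split.
- move=> [|r] [|c] [|c'] //= rn _ c'c TL; try by lia.
  have c'k : c' < k by lia.
  have ck : c < k by lia.
  move/forallP/(_ (Ordinal rn))/forallP/(_ (Ordinal ck)): row; rewrite tE TL eqxx /=.
  by move/forallP/(_ (Ordinal c'k)); rewrite tE /= => /implyP H; apply/eqP/H; lia.
- move=> [|c] // ck [|r] [|r'] // _ rr' TD; try by lia.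
  have rn : r < n by lia.
  have r'n : r' < n by lia.
  move/forallP/(_ (Ordinal rn))/forallP/(_ (Ordinal ck)): col; rewrite tE TD eqxx /=.
  by move/forallP/(_ (Ordinal r'n)); rewrite tE /= => /implyP H; apply/eqP/H; lia.
- apply/forallP => i; apply/forallP => j; apply/implyP; rewrite tE => /eqP TL.
  apply/forallP => j'; apply/implyP => j'j; rewrite tE.
  by apply/eqP; apply: row TL => //; have := ltn_ord i; have := ltn_ord j; lia.
- apply/forallP => i; apply/forallP => j; apply/implyP; rewrite tE => /eqP TL.
  apply/forallP => i'; apply/implyP => i'i; rewrite tE.
  by apply/eqP; apply: col TL => //; have := ltn_ord i'; have := ltn_ord j; lia.
Qed.

(** Brings an arbitrary matrix into the form to which [is_tableauP] applies; outside the rectangle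
    the value [Empty] is a mere default. *)
Lemma mx_entries n k (t : 'M[cell]_(n, k)) :
  exists T : nat -> nat -> cell, t = (\matrix_(i < n, j < k) T i.+1 j.+1)%R.
Proof.
exists (fun r c =>
  oapp (fun i : 'I_n => oapp (t i) Empty (insub c.-1)) Empty (insub r.-1)).
by apply/matrixP => i j; rewrite mxE /= !valK.
Qed.

Theorem theorem2p13 (n k : nat) :
  [/\ forall l, is_double_callan n k l -> is_tableau (F n k l),
      forall l1 l2, is_double_callan n k l1 -> is_double_callan n k l2 ->
        F n k l1 = F n k l2 -> l1 = l2,
      forall t : 'M[cell]_(n, k), is_tableau t ->
        exists2 l, is_double_callan n k l & F n k l = t
    & forall l, is_double_callan n k l -> w_st (F n k l) = w_lr l].
Proof.
split.
- by move=> l dl; apply/is_tableauP/F_cell_tableau.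
- move=> l1 l2 d1 d2 EF; apply: (F_cell_inj d1 d2) => -[|r] [|c] //; rewrite ?andbF //.
  move=> rn ck; move/matrixP/(_ (Ordinal rn) (Ordinal ck)): EF.
  by rewrite !mxE.
- move=> t; have [T ->] := mx_entries t => /is_tableauP /F_cell_surj[l dl El].
  by exists l => //; apply/matrixP => i j; rewrite !mxE El ?ltn_ord.
- move=> l dl; rewrite (w_lrE dl) -(records_left_col dl).
  exact/w_stE/F_cell_tableau.
Qed.
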